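(* Let $\widehat X=(X,h)$ be a generalized $N$-dimensional rectangle of a metric space $Z$. Let a finite sequence of $n$ indexes $i_1<i_2<\dots<i_n$ ($n\ge 1$) be fixed in $\{1,\dots,N\}$. Assume that, for each $j\in\{i_1,\dots,i_n\}$, there exists a compact set $\mathcal S_j\subseteq X$ such that $\mathcal S_j$ cuts the arcs between $X_j^{\ell}$ and $X_j^{r}$ in $X$. Then $\bigcap_{k=1}^n\mathcal S_{i_k}\neq\emptyset$ and there exists a compact connected subset $\mathcal Z$ of $\bigcap_{k=1}^n\mathcal S_{i_k}$ whose dimension at each point is at least $N-n$. Moreover, $$\dim(\mathcal Z\cap\vartheta X)\ge N-n-1$$ and $$\pi: h^{-1}(\mathcal Z)\cap\partial I^N\to\mathbb R^{N-n}\setminus\{0\}$$ is essential, where $\pi(x)=\bigl(x_j-\tfrac12\bigr)_{j\in\{1,\dots,N\}\setminus\{i_1,\dots,i_n\}}$.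
   Context: $I^N=[0,1]^N$, $\partial I^N$ is its boundary in $\mathbb R^N$, and $[x_i=k]=\{x\in I^N:x_i=k\}$. A generalized $N$-dimensional rectangle of a metric space $Z$ is a pair $\widehat X=(X,h)$ where $X\subseteq Z$ and $h:I^N\to X$ is a homeomorphism of $I^N$ onto $X$. Its left and right $i$-faces are $X_i^{\ell}=h([x_i=0])$, $X_i^{r}=h([x_i=1])$, and its contour is $\vartheta X=h(\partial I^N)$. Given closed nonempty sets $A,B,C\subseteq X$ with $A\cap B=\emptyset$, we say that $C$ cuts the arcs between $A$ and $B$ in $X$ if every continuous path $\gamma:[0,1]\to X$ whose range meets both $A$ and $B$ has range meeting $C$. $\dim$ is the covering dimension of a metric space. A metric space $\mathcal Z$ has dimension at least $j$ at $z_0\in\mathcal Z$ if each neighborhood of $z_0$ in $\mathcal Z$ has dimension at least $j$. A continuous map is inessential if it is homotopic to a constant map, and essential otherwise.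
   Formalization: The map π may vanish on part of h^{-1}(𝒵)∩∂I^N when some S_j touches its faces (e.g. S_1={0}×[0,1] in I²), so essentiality is stated for π on the points of h^{-1}(𝒵)∩∂I^N where π≠0; this is the whole set when each S_j misses its j-faces. *)

(* Defs.v *)
From HB Require Import structures.
From mathcomp Require Import all_boot all_order all_algebra.
From mathcomp Require Import all_classical all_reals all_analysis.

Set Implicit Arguments.
Unset Strict Implicit.
Unset Printing Implicit Defensive.

Import Order.TTheory GRing.Theory Num.Theory.
Import numFieldNormedType.Exports.

Local Open Scope classical_set_scope.
Local Open Scope ring_scope.

Definition cube (R : realType) (N : nat) : set 'rV[R]_N :=
  [set x | forall i, 0 <= x ord0 i <= 1].

Definition cube_boundary (R : realType) (N : nat) : set 'rV[R]_N :=
  closure (@cube R N) `\` interior (@cube R N).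

Definition homeomorphism_onto (T U : topologicalType)
    (A : set T) (B : set U) (f : T -> U) : Prop :=
  [/\ set_bij A B f, {within A, continuous f} &
      exists2 g : U -> T, {in A, cancel f g} & {within B, continuous g}].

(* The pair (X, h); only the values of h on the cube are relevant. *)
Definition gen_rectangle (R : realType) (N : nat) (Z : metricType R)
    (X : set Z) (h : 'rV[R]_N -> Z) : Prop :=
  homeomorphism_onto (@cube R N) X h.

Definition left_face (R : realType) (N : nat) (Z : metricType R)
    (h : 'rV[R]_N -> Z) (i : 'I_N) : set Z :=
  h @` [set x | cube x /\ x ord0 i = 0].

Definition right_face (R : realType) (N : nat) (Z : metricType R)
    (h : 'rV[R]_N -> Z) (i : 'I_N) : set Z :=
  h @` [set x | cube x /\ x ord0 i = 1].

Definition contour (R : realType) (N : nat) (Z : metricType R)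
    (h : 'rV[R]_N -> Z) : set Z :=
  h @` @cube_boundary R N.

Definition cuts_arcs (R : realType) (T : topologicalType)
    (X A B C : set T) : Prop :=
  forall gamma : R -> T,
    {within `[0, 1], continuous gamma} ->
    gamma @` `[0, 1] `<=` X ->
    gamma @` `[0, 1] `&` A !=set0 ->
    gamma @` `[0, 1] `&` B !=set0 ->
    gamma @` `[0, 1] `&` C !=set0.

(* dim A <= m for the covering dimension of the subspace A: every finite open
   cover of A has a finite open refinement such that no point of A lies in
   more than m + 1 of its members.  Relatively open subsets of A are given as
   traces of open sets of T.  With m = -1 this says that A is empty. *)
Definition covdim_le (T : topologicalType) (A : set T) (m : int) : Prop :=
  -1 <= m /\
  forall (p : nat) (U : 'I_p -> set T),
    (forall i, open (U i)) -> A `<=` \bigcup_i U i ->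
    exists (q : nat) (V : 'I_q -> set T),
      [/\ forall j, open (V j),
          A `<=` \bigcup_j V j,
          forall j, exists i, A `&` V j `<=` U i &
          forall x, A x -> (#|[pred j | `[< V j x >]]|)%:Z <= m + 1].

(* The dimension is the least m with covdim_le A m (infinite if there is
   none, and -1 for the empty set). *)
Definition covdim_ge (T : topologicalType) (A : set T) (m : int) : Prop :=
  forall k : int, covdim_le A k -> m <= k.

Definition covdim_ge_at (T : topologicalType) (A : set T) (z : T) (m : int) :
    Prop :=
  forall W : set T, nbhs z W -> covdim_ge (A `&` W) m.

(* f and g are homotopic as maps D -> Y. *)
Definition homotopic_on (R : realType) (T U : topologicalType)
    (D : set T) (Y : set U) (f g : T -> U) : Prop :=
  exists H : R * T -> U,
    [/\ {within `[0, 1] `*` D, continuous H},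
        H @` (`[0, 1] `*` D) `<=` Y,
        forall x, D x -> H (0, x) = f x &
        forall x, D x -> H (1, x) = g x].

Definition inessential (R : realType) (T U : topologicalType)
    (D : set T) (Y : set U) (f : T -> U) : Prop :=
  exists2 c : U, Y c & homotopic_on R D Y f (fun=> c).

(* f restricts to a continuous map D -> Y, and this map is essential. *)
Definition essential (R : realType) (T U : topologicalType)
    (D : set T) (Y : set U) (f : T -> U) : Prop :=
  [/\ {within D, continuous f}, f @` D `<=` Y & ~ inessential R D Y f].

Definition punctured_space (R : realType) (m : nat) : set 'rV[R]_m :=
  [set y | y != 0].

(* x |-> (x_j - 1/2)_(j \notin J), coordinates in increasing order of j. *)
Definition centered_proj (R : realType) (N : nat) (J : {set 'I_N})
    (x : 'rV[R]_N) : 'rV[R]_#|(~: J)%SET| :=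
  \row_k (x ord0 (enum_val k) - 2^-1).

(* The points of h^-1(K) on the boundary of the cube at which centered_proj
   takes its values in the punctured space.  When K meets none of the faces
   x_j = 0 and x_j = 1 with j in J, this is all of h^-1(K) on the boundary. In
   general centered_proj may vanish on a boundary point lying on such a face
   (e.g. at (0, 1/2) for N = 2 if the first coordinate vanishes on h^-1(K)),
   and does not define a map into the punctured space there. *)
Definition boundary_trace (R : realType) (N : nat) (Z : metricType R)
    (h : 'rV[R]_N -> Z) (J : {set 'I_N}) (K : set Z) : set 'rV[R]_N :=
  [set x | [/\ K (h x), cube_boundary x & centered_proj J x != 0]].

(* Main.v *)
Require Import Defs.
From HB Require Import structures.
From mathcomp Require Import all_boot all_order all_algebra.
From mathcomp Require Import all_classical all_reals all_analysis.
From mathcomp Require Import lra zify.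

(* Pull everything back to the cube, write m = N - n, and call a compact K
   linking if every continuous extension to R^N of the projection to R^m on the
   faces x_j = 0, 1 with j not in J vanishes somewhere on K.  A set S_j that
   cuts the arcs between the two j-faces contains the zeros of a signed distance
   function to S_j, so the Poincare-Miranda theorem shows that the intersection
   of the S_j is linking.  By compactness and Zorn's lemma it contains a minimal
   linking set, which is connected: if it were the union of two disjoint proper
   closed subsets, nonvanishing extensions on the two could be glued.  If it had
   dimension < m near a point z, an extension with no zero off a neighbourhood
   of z could be perturbed near z to avoid 0, a set of dimension < m being mapped
   off 0 by a generic map into R^m.  If the projection on the trace on the
   boundary were inessential, Borsuk's homotopy extension theorem would give a
   nonvanishing extension; this also excludes that the trace has dimension
   < m - 1, since a generic map then misses a whole line through 0. *)

Set Implicit Arguments.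
Unset Strict Implicit.
Unset Printing Implicit Defensive.

Import Order.TTheory GRing.Theory Num.Theory.
Import numFieldNormedType.Exports.

Local Open Scope ring_scope.

(** * A mod 2 cubical Sperner lemma *)

Lemma addrr_F2 (x : 'F_2) : x + x = 0.
Proof. by rewrite -mulr2n -mulr_natr (pchar_Fp_0 (p := 2)) ?mulr0. Qed.

Lemma oppr_F2 (x : 'F_2) : - x = x.
Proof. by apply/eqP; rewrite eq_sym -addr_eq0 addrr_F2. Qed.

Lemma F2_neq0 (x : 'F_2) : x != 0 -> x = 1.
Proof. by case: x => -[|[|]] // ? _; apply: val_inj. Qed.

(** Each unordered pair is counted twice, and 2 = 0; the ranking [r] selects one order of each
    pair. *)
Lemma sum_sym_offdiag (I : finType) (D : {set I}) (f : I -> I -> 'F_2) :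
    (forall i j, f i j = f j i) ->
  \sum_(i in D) \sum_(j in D :\ i) f i j = 0.
Proof.
move=> fC; pose r : I -> nat := enum_rank.
have -> : \sum_(i in D) \sum_(j in D :\ i) f i j =
  \sum_(i in D) \sum_(j in D | (r i < r j)%N) f i j +
  \sum_(i in D) \sum_(j in D | (r j < r i)%N) f i j.
  rewrite -big_split /=; apply: eq_bigr => i _.
  rewrite (bigID (fun j => (r i < r j)%N)) /=; congr (_ + _); apply: eq_bigl => j.
    rewrite !inE; case: eqVneq => [->|_]; first by rewrite ltnn !andbF.
    by [].
  rewrite !inE -leqNgt leq_eqVlt (inj_eq val_inj) (inj_eq enum_rank_inj).
  by case: eqVneq => [->|_] //=; rewrite ltnn andbF.
rewrite [X in _ + X](exchange_big_dep (mem D)) /=; last by move=> ? ? _ /andP[].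
rewrite -big_split big1 // => i iD /=.
rewrite [X in _ + X](eq_big (fun j => (j \in D) && (r i < r j)%N) (f i)).
- exact: addrr_F2.
- by move=> j; rewrite iD.
- by move=> j _; rewrite fC.
Qed.

(** * Cup products of mod 2 coboundaries *)

Section Cochain.
Variables (I : finType) (G : zmodType) (e : I -> G).
Variables (K : eqType) (s : K -> G -> 'F_2).
Implicit Types (D E : {set I}) (z : G) (l : seq K).

(* The value of the cup product of the coboundaries of s k, for k in l, on the
   cube with lowest vertex z and set of directions D. *)
Fixpoint cup D z l : 'F_2 :=
  if l is k :: l' then
    \sum_(i in D) (s k (z + e i) - s k z) * cup (D :\ i) (z + e i) l'
  else 1.

Lemma setD1C D i j : D :\ i :\ j = D :\ j :\ i.
Proof. by rewrite !finset.setDDl finset.setUC. Qed.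

(** Coboundaries are closed, hence so is their product: its values on the facets of a cube cancel
    mod 2. *)
Lemma cup_cocycle D z l :
  \sum_(i in D) (cup (D :\ i) (z + e i) l + cup (D :\ i) z l) = 0.
Proof.
elim: l D z => [|k l IH] D z; first by rewrite big1 // => i _; exact: addrr_F2.
pose c E y := cup E y l.
pose A i j := s k (z + e i + e j) * c (D :\ i :\ j) (z + e i + e j).
pose B i j :=
  s k (z + e i) * (c (D :\ i :\ j) (z + e i + e j) + c (D :\ i :\ j) (z + e i)).
pose C i j := s k z * (c (D :\ i :\ j) (z + e j) + c (D :\ i :\ j) z).
pose C' i j := s k z * c (D :\ i :\ j) z.
pose B1 i j := s k (z + e i) * c (D :\ i :\ j) (z + e i).
(* The first and last sums are symmetric in [i] and [j]; those of [B] and [C] vanish by the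
   induction hypothesis for the directions [D :\ i] at [z + e i] and at [z]. *)
have -> : \sum_(i in D) (cup (D :\ i) (z + e i) (k :: l) +
     cup (D :\ i) z (k :: l)) =
  \sum_(i in D) \sum_(j in D :\ i) (A i j + (B1 i j + B1 j i)) +
  \sum_(i in D) \sum_(j in D :\ i) B i j +
  \sum_(i in D) \sum_(j in D :\ i) C i j +
  \sum_(i in D) \sum_(j in D :\ i) C' i j.
  rewrite -!big_split; apply: eq_bigr => i _ /=.
  rewrite -!big_split; apply: eq_bigr => j _ /=.
  rewrite /A /B /C /C' /B1 -!/(c _ _) (setD1C D j i) !oppr_F2 !mulrDr !mulrDl.
  set a1 := _ * c _ (_ + _ + _); set a2 := s k (z + e i) * c _ (_ + _ + _).
  set a3 := s k (z + e j) * _; set a4 := s k z * _; set a5 := _ * c _ (z + e i).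
  set a6 := s k z * c _ z.
  have -> : a1 + (a5 + a3) + (a2 + a5) + (a4 + a6) + a6 =
    a1 + a2 + (a3 + a4) + ((a5 + a5) + (a6 + a6)).
    rewrite -!addrA; congr (_ + _); rewrite !addrA -(addrC a2) -!addrA.
    congr (_ + _); rewrite (addrCA a5 a3); congr (_ + _).
    by rewrite (addrCA a5 a4) (addrCA a5 a4).
  by rewrite !addrr_F2 !addr0.
rewrite sum_sym_offdiag ?[X in _ + X]sum_sym_offdiag; first last.
- by move=> i j; rewrite /A (setD1C D j i) [B1 _ _ + _]addrC [in RHS]addrAC.
- by move=> i j; rewrite /C' (setD1C D j i).
rewrite add0r addr0 !big1 ?addr0 // => i iD.
  by rewrite /C -mulr_sumr IH mulr0.
by rewrite /B -mulr_sumr IH mulr0.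
Qed.

(** The factor belonging to [k] is a difference of two values of [s k] at vertices of the cube,
    hence 0. *)
Lemma cup_const D z l k : k \in l ->
  (forall E, E \subset D -> s k (z + \sum_(i in E) e i) = s k z) ->
  cup D z l = 0.
Proof.
elim: l D z => // k' l IH D z; rewrite inE => /orP[/eqP <-|kl] sE /=.
  rewrite big1 // => i iD; have := sE [set i].
  by rewrite finset.sub1set iD big_set1 => ->; rewrite ?subrr ?mul0r.
rewrite big1 // => i iD; rewrite IH ?mulr0 // => E ED.
have iE : i \notin E by apply/negP => /(fintype.subsetP ED); rewrite !inE eqxx.
have ED' : i |: E \subset D.
  by rewrite finset.subUset finset.sub1set iD (fintype.subset_trans ED) ?finset.subsetDl.
have := sE _ ED'; rewrite big_setU1 //= addrA => ->.
by have := sE [set i]; rewrite finset.sub1set iD big_set1 => ->.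
Qed.

(** The product over [l] being closed, the whole product is the coboundary of [s k] times it: a sum
    over facets, which telescopes on the grid. *)
Lemma cup_cons D z k l :
  cup D z (k :: l) = \sum_(i in D)
    (s k (z + e i) * cup (D :\ i) (z + e i) l + s k z * cup (D :\ i) z l).
Proof.
have := congr1 (fun x => cup D z (k :: l) + s k z * x) (cup_cocycle D z l).
rewrite mulr0 addr0 => <- /=; rewrite mulr_sumr -big_split /=.
apply: eq_bigr => i _; rewrite oppr_F2 mulrDl mulrDr -addrA; congr (_ + _).
by rewrite addrA addrr_F2 add0r.
Qed.
End Cochain.

(** * Counting cells of a labelled grid *)

Section Grid.
Variables (I : finType) (p : nat).
Local Notation grid := {ffun I -> 'I_p.+2}.
Implicit Types (D : {set I}) (b y : grid).

Definition unit_step (i : I) : grid := [ffun j => (j == i)%:R].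

(* Lowest vertices of the cubes with set of directions D in the face through b;
   addition on the grid is cyclic, but does not wrap around on these cubes. *)
Definition cells D b : {set grid} :=
  [set y : grid | [forall i, if i \in D then y i != ord_max else y i == b i]].

Definition set_coord b i c : grid := [ffun j => if j == i then c else b j].

Lemma sum_unit_step (E : {set I}) j :
  (\sum_(i in E) unit_step i : grid) j = (j \in E)%:R.
Proof.
rewrite sum_ffunE; have [jE|jE] := boolP (j \in E).
  rewrite (bigD1 j) //= ffunE eqxx big1 ?addr0 // => i /andP[_ ij].
  by rewrite ffunE eq_sym (negbTE ij).
by rewrite big1 // => i iE; rewrite ffunE; case: eqVneq jE iE => // -> /negP.
Qed.

Lemma ord_max_add1 : (ord_max + 1 : 'I_p.+2) = 0.
Proof. by apply: val_inj; rewrite /= modnDmr addn1 modnn. Qed.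

(** Terms with [y i] strictly between the extremes occur twice and cancel mod 2; the two end layers
    remain. *)
Lemma sum_cells_step D b i (F : grid -> 'F_2) : i \in D ->
  \sum_(y in cells D b) (F (y + unit_step i) + F y) =
  \sum_(y in cells (D :\ i) (set_coord b i ord_max)) F y +
  \sum_(y in cells (D :\ i) (set_coord b i 0)) F y.
Proof.
move=> iD; rewrite big_split /=.
(* [P] leaves the coordinate [i] free, so that each sum becomes one over [P] with a condition on
   [y i]. *)
pose P y := [forall j, if j \in D then (j != i) ==> (y j != ord_max) else y j == b j].
have PC c : \sum_(y in cells (D :\ i) (set_coord b i c)) F y =
   \sum_(y | P y && (y i == c)) F y.
  apply: eq_bigl => y; rewrite inE; apply/forallP/andP => [H|[/forallP H yi] j].
    split; last by have := H i; rewrite !inE eqxx ffunE eqxx.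
    apply/forallP => j; have := H j; rewrite !inE ffunE.
    by case: eqVneq => [->|]//=; rewrite iD.
  have := H j; rewrite !inE ffunE; case: eqVneq => [->|]//=.
have split c : \sum_(y | P y && (y i != c)) F y =
    \sum_(y | P y) F y + \sum_(y in cells (D :\ i) (set_coord b i c)) F y.
  rewrite PC [X in X + _](bigID (fun y : grid => y i == c)) /=.
  by rewrite addrAC addrr_F2 add0r.
have -> : \sum_(y in cells D b) F y = \sum_(y | P y && (y i != ord_max)) F y.
  apply: eq_bigl => y; rewrite inE; apply/forallP/andP => [H|[/forallP H yi] j].
    split; last by have := H i; rewrite iD.
    by apply/forallP => j; have := H j; case: ifP => // _ ->; rewrite implybT.
  by have := H j; case: ifP => //; case: eqVneq => [->|].
have -> : \sum_(y in cells D b) F (y + unit_step i) =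
    \sum_(y | P y && (y i != 0)) F y.
  rewrite [RHS](reindex (fun y => y + unit_step i)); last first.
    by apply: onW_bij; exists (fun y => y - unit_step i) => y; rewrite ?addrK ?subrK.
  apply: eq_bigl => y; rewrite inE.
  have yE j : (y + unit_step i) j = y j + (j == i)%:R by rewrite !ffunE.
  apply/forallP/andP => [H|[/forallP H yi] j].
    split; last first.
      have := H i; rewrite iD yE eqxx; apply: contraNN => /eqP y0.
      by apply/eqP/(addIr 1); rewrite y0 ord_max_add1.
    apply/forallP => j; have := H j; rewrite yE; case: ifP => jD.
      by case: (eqVneq j i) => //= _; rewrite addr0.
    by case: (eqVneq j i) jD => [->|]; rewrite ?iD ?addr0.
  have := H j; rewrite yE; case: ifP => jD.
    case: (eqVneq j i) => [->|] //=; last by rewrite addr0.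
    move: yi; rewrite yE eqxx => + _; apply: contraNN => /eqP ->.
    by rewrite ord_max_add1.
  by case: (eqVneq j i) jD => [->|]; rewrite ?iD ?addr0.
rewrite !split addrACA addrr_F2 add0r; exact: addrC.
Qed.

Variable s : I -> grid -> 'F_2.
Hypothesis s0 : forall i y, y i = 0 -> s i y = 0.
Hypothesis s1 : forall i y, y i = ord_max -> s i y = 1.

(** The sum telescopes to the boundary of the grid. On both faces in a direction [i] other than [k],
    [s i] is constant and the product vanishes; on the lower [k]-face [s k] is 0, and on the upper
    one it is 1, which leaves the sum for [l]. *)
Lemma sum_cup (l : seq I) b : uniq l ->
  \sum_(y in cells [set i in l] b) cup unit_step s [set i in l] y l = 1.
Proof.
elim: l b => [|k l IH] b.
  move=> _; rewrite (big_pred1 b) // => y; rewrite !inE; apply/forallP/eqP.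
    by move=> H; apply/ffunP => i; have := H i; rewrite !inE => /eqP.
  by move=> -> i; rewrite inE eqxx.
case/andP=> kl ul; set D := [set i in k :: l].
have DE : D :\ k = [set i in l].
  by apply/finset.setP => j; rewrite !inE; case: eqVneq => // ->; rewrite (negbTE kl).
have kD : k \in D by rewrite !inE eqxx.
under eq_bigr do rewrite cup_cons.
rewrite exchange_big /= (bigD1 k) //= [X in _ + X]big1 ?addr0; last first.
  move=> i /andP[iD ik].
  rewrite (sum_cells_step b (fun y => s k y * cup unit_step s (D :\ i) y l) iD).
  have il : i \in l by move: iD; rewrite !inE (negbTE ik).
  have z c v : (forall y, y i = c -> s i y = v) ->
    \sum_(y in cells (D :\ i) (set_coord b i c))
      s k y * cup unit_step s (D :\ i) y l = 0.
    move=> sc; rewrite big1 // => y; rewrite inE => /forallP /(_ i).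
    rewrite !inE eqxx /= ffunE eqxx => /eqP yi.
    rewrite (@cup_const _ _ _ _ _ _ _ _ i) ?mulr0 // => E ED.
    rewrite (sc y) // sc // ffunE sum_unit_step yi.
    case: (boolP (i \in E)) => [/(fintype.subsetP ED)|]; first by rewrite !inE eqxx.
    by rewrite addr0.
  by rewrite (z _ 1) ?(z _ 0) ?addr0 // => y; [apply: s0|apply: s1].
rewrite (sum_cells_step b (fun y => s k y * cup unit_step s (D :\ k) y l) kD).
rewrite [X in _ + X]big1 ?addr0; last first.
  move=> y; rewrite inE => /forallP /(_ k).
  by rewrite !inE eqxx /= ffunE eqxx => /eqP /s0 ->; rewrite mul0r.
rewrite DE -[RHS](IH (set_coord b k ord_max) ul); apply: eq_bigr => y.
rewrite inE => /forallP /(_ k); rewrite !inE (negbTE kl) ffunE eqxx => /eqP /s1 ->.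
by rewrite mul1r.
Qed.

(** The products over all cells sum to 1, so one of them is nonzero; on that cell no [s k] is
    constant. *)
Lemma sperner_cell :
  exists y : grid, (forall i, y i != ord_max) /\
   forall k, exists E : {set I}, s k (y + \sum_(i in E) unit_step i) <> s k y.
Proof.
pose D := [set i in enum I].
have /eqP := sum_cup 0 (enum_uniq I).
have [/existsP[y /andP[yc /eqP cy]] _|/existsPn H] :=
    boolP [exists y, (y \in cells D 0) && (cup unit_step s D y (enum I) != 0)].
  exists y; split=> [i|k].
    by move: yc; rewrite inE => /forallP/(_ i); rewrite inE mem_enum.
  have [/existsP[E /eqP sE]|/existsPn H] :=
    boolP [exists E : {set I}, s k (y + \sum_(i in E) unit_step i) != s k y].
    by exists E.
  case: cy; apply: (@cup_const _ _ _ _ _ _ _ _ k); rewrite ?mem_enum // => E _.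
  by have := H E; rewrite negbK => /eqP.
rewrite big1 // => y yc; have := H y.
by rewrite yc /= negbK => /eqP.
Qed.

End Grid.

Local Open Scope classical_set_scope.

(** * The Poincare-Miranda theorem *)

Section Within.
Variables (T U : topologicalType) (A : set T) (f : T -> U).

Lemma within_continuousP :
  {within A, continuous f} <->
  forall x B, A x -> nbhs (f x) B -> \forall y \near x, A y -> B (f y).
Proof.
split=> [cf x B Ax fB|cf].
  have := cf x B fB; rewrite /= /nbhs /=.
  by rewrite -nbhs_subspace_in.
rewrite continuous_subspace_in => x /set_mem Ax B fB.
by rewrite /= /nbhs /= -nbhs_subspace_in //; exact: cf.
Qed.
End Within.

Section RowNorm.
Variables (R : realType) (n : nat).
Implicit Types (x : 'rV[R]_n).

Lemma rV_norm_le x (a : R) :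
  0 <= a -> (forall j, `|x ord0 j| <= a) -> `|x| <= a.
Proof.
move=> a0 xa; rewrite /Num.norm /= mx_normrE; apply/bigmax_leP; split=> // -[i j] _.
by rewrite ord1; exact: xa.
Qed.

Lemma coord_norm_le x j : `|x ord0 j| <= `|x|.
Proof.
rewrite [leRHS]/Num.norm /= mx_normrE; apply/bigmax_geP; right.
by exists (ord0, j).
Qed.
End RowNorm.

Lemma cube_compact (R : realType) N : compact (@cube R N).
Proof.
have := @rV_compact R N (fun=> `[0, 1]%classic) (fun=> @segment_compact R 0 1).
by congr (compact _); apply/seteqP; split=> x /= H i; have := H i; rewrite in_itv.
Qed.

Lemma cube_closed (R : realType) N : closed (@cube R N).
Proof. by apply: compact_closed (@cube_compact R N); exact: norm_hausdorff. Qed.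

Section PoincareMiranda.
Variables (R : realType) (N : nat) (F : 'I_N -> 'rV[R]_N -> R).
Hypothesis F_cont : forall k, {within @cube R N, continuous F k}.
Hypothesis F_left : forall k x, cube x -> x ord0 k = 0 -> F k x <= 0.
Hypothesis F_right : forall k x, cube x -> x ord0 k = 1 -> 0 <= F k x.

(** The grid of mesh [1 / (p + 1)] is labelled by the sign of [F k]; a cell on which every label
    changes has vertices of both signs for each [k]. *)
Lemma small_sign_changing_cell (p : nat) :
  exists2 x, cube x & forall k, exists a b : 'rV[R]_N,
    [/\ cube a, cube b, `|x - a| <= p.+1%:R^-1, `|x - b| <= p.+1%:R^-1 &
     F k a <= 0 <= F k b].
Proof.
pose pt (y : {ffun 'I_N -> 'I_p.+2}) : 'rV[R]_N := \row_k ((y k)%:R / p.+1%:R).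
have pt_cube y : cube (pt y).
  move=> k; rewrite mxE divr_ge0 //= ler_pdivrMr ?mul1r ?ltr0n // ler_nat.
  by rewrite -ltnS ltn_ord.
(* At [y k = ord_max] the label is 1 even where [F k] vanishes; the hypotheses on the faces keep
   every label compatible with the weak sign of [F k]. *)
pose s k (y : {ffun 'I_N -> 'I_p.+2}) : 'F_2 :=
  if y k == 0 then 0 else if y k == ord_max then 1 else (0 < F k (pt y))%R%:R.
have s0 k (y : {ffun 'I_N -> 'I_p.+2}) : y k = 0 -> s k y = 0 by rewrite /s => ->; rewrite eqxx.
have s1 k (y : {ffun 'I_N -> 'I_p.+2}) : y k = ord_max -> s k y = 1 by rewrite /s => ->; rewrite eqxx.
have [y [ymax sy]] := sperner_cell s0 s1.
have sle z k : s k z = 0 -> F k (pt z) <= 0.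
  rewrite /s; case: eqP => [z0 _|_].
    by apply: F_left; rewrite // mxE z0 mul0r.
  by case: ifP => // _; case: (leP (F k (pt z)) 0).
have sge z k : s k z <> 0 -> 0 <= F k (pt z).
  rewrite /s; case: eqP => // _; case: eqP => [zm _|_].
    by apply: F_right; rewrite // mxE zm /= divff // pnatr_eq0.
  by case: (ltP 0 (F k (pt z))) => // /ltW.
have d (E : {set 'I_N}) : `|pt y - pt (y + \sum_(i in E) unit_step p i)| <= p.+1%:R^-1.
  apply: rV_norm_le; first by rewrite invr_ge0.
  move=> j; rewrite !mxE -mulrBl normrM [X in _ * X]ger0_norm ?invr_ge0 //.
  rewrite -[leRHS]mul1r ler_wpM2r ?invr_ge0 // ffunE sum_unit_step.
  have yj : (y j < p.+1)%N.
    by have := ymax j; rewrite -val_eqE /= ltn_neqAle -ltnS ltn_ord => ->.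
  case: (j \in E); last by rewrite addr0 subrr normr0.
  rewrite /= modnDmr modn_small ?addn1 // -natr1 opprD addrA subrr add0r.
  by rewrite normrN normr1.
exists (pt y) => // k; have [E] := sy k.
have yy : `|pt y - pt y| <= p.+1%:R^-1 by rewrite subrr normr0 invr_ge0.
have [y0|/eqP y0] := eqVneq (s k y) 0 => sE.
  exists (pt y), (pt (y + \sum_(i in E) unit_step p i)); split=> //.
  by rewrite sle // sge // -y0.
exists (pt (y + \sum_(i in E) unit_step p i)), (pt y); split=> //.
rewrite sge // sle //; case: (eqVneq (s k (y + \sum_(i in E) unit_step p i)) 0) => //.
by move: y0 sE => /eqP/F2_neq0 -> ? /F2_neq0.
Qed.

(** Ever smaller sign-changing cells cluster at some [x]. If [F k x] were nonzero, [F k] would have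
    constant strict sign near [x], hence on a small cell close to it. *)
Theorem poincare_miranda : exists2 x, cube x & forall k, F k x = 0.
Proof.
have /choice[u u_cell] : forall p, exists x, cube x /\ forall k, exists a b : 'rV[R]_N,
    [/\ cube a, cube b, `|x - a| <= p.+1%:R^-1, `|x - b| <= p.+1%:R^-1 &
     F k a <= 0 <= F k b].
  by move=> p; have [x] := small_sign_changing_cell p; exists x.
have [|x [cx xu]] := @cube_compact R N (u @ \oo) _.
  by apply: filterS (filterT : \forall _ \near \oo, True) => p _; exact: (u_cell p).1.
exists x => // k.
have near_u (e : R) : 0 < e -> exists p, [/\ p.+1%:R^-1 < e & `|x - u p| < e].
  move=> e0; have [_ [[p pe <-]]] : [set u p | p in [set p | p.+1%:R^-1 < e]] `&` ball x e !=set0.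
    apply: xu; last exact: nbhsx_ballx.
    by apply: filterS (near_infty_natSinv_lt (PosNum e0)) => p pe; exists p.
  by rewrite -ball_normE /= => ?; exists p.
have key e : (forall y, cube y -> `|x - y| < e -> F k y < 0) \/
    (forall y, cube y -> `|x - y| < e -> 0 < F k y) -> 0 < e -> False.
  move=> Fs e0; have [|p [pe xp]] := near_u (e / 2); first by rewrite divr_gt0.
  have [_ /(_ k)[a [b [ca cb ua ub /andP[Fa Fb]]]]] := u_cell p.
  have lt y : `|u p - y| <= p.+1%:R^-1 -> `|x - y| < e.
    move=> uy; rewrite -(subrKA (u p)) (le_lt_trans (ler_normD _ _)) //.
    by rewrite (splitr e) ltrD // (le_lt_trans uy).
  case: Fs => Fs; first by have := Fs b cb (lt _ ub); rewrite ltNge Fb.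
  by have := Fs a ca (lt _ ua); rewrite ltNge Fa.
have cF B := (within_continuousP _ _).1 (@F_cont k) x B cx.
have [Fx|Fx|//] := ltgtP (F k x) 0; exfalso.
- have /cF /nbhs_ballP [e /= e0 eF] : nbhs (F k x) [set z | z < 0].
    by apply: open_nbhs_nbhs; split=> //; exact: open_lt.
  apply: (key e) => //; left=> y cy xy; apply: eF => //.
  by rewrite -ball_normE.
- have /cF /nbhs_ballP [e /= e0 eF] : nbhs (F k x) [set z | 0 < z].
    by apply: open_nbhs_nbhs; split=> //; exact: open_gt.
  apply: (key e) => //; right=> y cy xy; apply: eF => //.
  by rewrite -ball_normE.
Qed.
End PoincareMiranda.

(** * Sets cutting arcs *)

Section CappedDistance.
Variables (R : realType) (V : normedModType R) (A : set V).

(* Capped at 1 because the infimum of an empty set is 0. *)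
Definition capped_dist (x : V) : R := inf (1 |` [set `|x - a| | a in A]).

Let lbnd x : lbound (1 |` [set `|x - a| | a in A]) 0.
Proof. by move=> _ [->|[a _ <-]]. Qed.

Lemma capped_dist_ge0 x : 0 <= capped_dist x.
Proof. by apply: lb_le_inf; [exists 1; left|exact: lbnd]. Qed.

Lemma capped_dist_le x a : A a -> capped_dist x <= `|x - a|.
Proof.
by move=> Aa; apply: ge_inf; [exists 0; exact: lbnd|right; exists a].
Qed.

Lemma capped_dist_lip x y : `|capped_dist x - capped_dist y| <= `|x - y|.
Proof.
have lip u v : capped_dist u - `|u - v| <= capped_dist v.
  apply: lb_le_inf; first by exists 1; left.
  move=> _ [->|[a Aa <-]]; rewrite lerBlDr.
    rewrite (@le_trans _ _ 1) ?lerDl //.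
    by apply: ge_inf; [exists 0; exact: lbnd|left].
  by rewrite (le_trans (capped_dist_le u Aa)) // [leRHS]addrC -[u - a](subrKA v) ler_normD.
have := lip x y; have := lip y x; rewrite (distrC y x) ler_norml; lra.
Qed.

Lemma capped_dist_eq0 x : closed A -> capped_dist x = 0 -> A x.
Proof.
move=> cA d0; apply: contrapT => Ax.
have /nbhs_ballP[e /= e0 eA] : nbhs x (~` A).
  by apply: open_nbhs_nbhs; split=> //; exact: closed_openC.
suff : Num.min 1 e <= capped_dist x by rewrite d0 leNgt lt_min ltr01 e0.
apply: lb_le_inf; first by exists 1; left.
move=> _ [->|[a Aa <-]]; rewrite ge_min ?lexx // orbC leNgt.
by apply/orP; left; apply/negP => xa; apply: (eA a) => //; rewrite -ball_normE.
Qed.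

Lemma capped_dist_gt0 x : closed A -> ~ A x -> 0 < capped_dist x.
Proof.
by move=> cA Ax; rewrite lt_def capped_dist_ge0 andbT; apply/eqP => /capped_dist_eq0-/(_ cA).
Qed.

Lemma capped_dist_continuous : continuous capped_dist.
Proof.
move=> x B /nbhs_ballP[e /= e0 eB]; apply/nbhs_ballP; exists e => //= y.
rewrite -ball_normE /= => xy; apply: eB; rewrite -ball_normE /=.
exact: le_lt_trans (capped_dist_lip _ _) xy.
Qed.
End CappedDistance.

Section Clamp.
Variable R : realType.

Definition clamp01 (t : R) : R := Num.max 0 (Num.min t 1).

Lemma clamp01_itv t : 0 <= clamp01 t <= 1.
Proof. by rewrite /clamp01 le_max lexx ge_max ler01 ge_min lexx orbT. Qed.

Lemma clamp01_le0 t : t <= 0 -> clamp01 t = 0.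
Proof. by move=> t0; apply/max_idPl; rewrite ge_min t0. Qed.

Lemma clamp01_ge1 t : 1 <= t -> clamp01 t = 1.
Proof. by move=> t1; rewrite /clamp01 (min_idPr t1); apply/max_idPr. Qed.

Lemma clamp01_continuous : continuous clamp01.
Proof.
move=> t.
suff : {for t, continuous ((fun=> 0 : R) \max (fun t : R => Num.min t 1))} by [].
apply: (@continuous_max R R); first exact: cvg_cst.
by apply: (@continuous_min R R); [exact: cvg_id|exact: cvg_cst].
Qed.
End Clamp.

Section CuttingFunction.
Variables (R : realType) (N : nat) (j : 'I_N) (S : set 'rV[R]_N).
Local Notation V := 'rV[R]_N.
Hypothesis S_closed : closed S.
Hypothesis S_cuts : forall gamma : R -> V, continuous gamma ->
  (forall t, cube (gamma t)) -> gamma 0 ord0 j = 0 -> gamma 1 ord0 j = 1 ->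
  exists t, S (gamma t).

(** Paths are continuous on all of [R], so that they can be concatenated by clamping the
    parameter. *)
Definition reachable (x : V) := exists gamma : R -> V,
  [/\ continuous gamma, forall t, cube (gamma t) /\ ~ S (gamma t),
      gamma 0 ord0 j = 0 & gamma 1 = x].

Lemma cube_segment (x y : V) (t : R) : cube x -> cube y -> 0 <= t <= 1 ->
  cube (x + t *: (y - x)).
Proof.
move=> cx cy /andP[t0 t1] i; have := cx i; have := cy i; rewrite !mxE.
move=> /andP[? ?] /andP[? ?]; apply/andP; split; nra.
Qed.

Lemma reachable_segment x y : reachable x -> cube y ->
  (forall t, 0 <= t <= 1 -> ~ S (x + t *: (y - x))) -> reachable y.
Proof.
move=> [g [cg gS g0 g1]] cy xyS.
(* [u] runs through the old path up to time 1/2, then [v] runs through the segment; clamping keeps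
   each constant while the other moves. *)
pose u t : R := clamp01 (2 * t); pose v t : R := clamp01 (2 * t - 1).
have c2 : continuous (fun t : R => 2 * t).
  by move=> t; apply: cvgM; [exact: cvg_cst|exact: cvg_id].
exists (fun t => g (u t) + v t *: (y - x)); split.
- move=> t; apply: (@cvgD R V).
    apply: (@continuous_comp _ _ _ u g); last exact: cg.
    by apply: continuous_comp; [exact: c2|exact: clamp01_continuous].
  apply: (@cvgZ R V); last exact: cvg_cst.
  apply: (@continuous_comp _ _ _ (fun t : R => 2 * t - 1)).
    by apply: (@cvgB R R^o); [exact: c2|exact: cvg_cst].
  exact: clamp01_continuous.
- move=> t; have [t1|/ltW t1] := leP (2 * t) 1.
    by rewrite /v clamp01_le0 ?subr_le0 // scale0r addr0.
  rewrite /u clamp01_ge1 // g1; split; last by apply: xyS; exact: clamp01_itv.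
  by apply: cube_segment (clamp01_itv _) => //; rewrite -g1; exact: (gS 1).1.
- by rewrite /u /v !clamp01_le0 ?mulr0 ?sub0r ?lerN10 // scale0r addr0.
- rewrite /u /v !clamp01_ge1 ?g1 ?scale1r 1?addrC ?subrK //; lra.
Qed.

(* The witness is the distance to S, taken negative at the points reachable from
   the left face: a segment from a reachable to an unreachable point meets S, so
   changing the sign keeps the function 1-Lipschitz. *)
Lemma cutting_function : exists g : V -> R,
  [/\ forall x y, cube x -> cube y -> `|g x - g y| <= `|x - y|,
      forall x, g x = 0 -> S x,
      forall x, cube x -> x ord0 j = 0 -> g x <= 0 &
      forall x, cube x -> x ord0 j = 1 -> 0 <= g x].
Proof.
pose d := capped_dist S.
exists (fun x => if `[< reachable x >] then - d x else d x); split.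
- have sep x y : cube x -> cube y -> reachable x -> ~ reachable y ->
      `|d x + d y| <= `|x - y|.
    move=> cx cy rx ry; rewrite ger0_norm ?addr_ge0 ?capped_dist_ge0 //.
    have [t [/andP[t0 t1] St]] : exists t, 0 <= t <= 1 /\ S (x + t *: (y - x)).
      apply: contrapT => nS; apply: ry; apply: reachable_segment rx cy _.
      by move=> t t01 St; apply: nS; exists t.
    (* The point of [S] bounds both distances; it divides the segment in the ratio [t] to [1 - t],
       so the bounds add up to the length. *)
    rewrite (le_trans (lerD (capped_dist_le _ St) (capped_dist_le _ St))) //.
    have -> : x - (x + t *: (y - x)) = t *: (x - y).
      by rewrite opprD addrA subrr add0r -scalerN opprB.
    have -> : y - (x + t *: (y - x)) = (t - 1) *: (x - y).
      rewrite opprD addrA scalerBl scale1r opprB -[t *: (y - x)]opprK -scalerN opprB opprK.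
      exact: addrC.
    rewrite !normrZ -mulrDl (ger0_norm t0) ler0_norm ?subr_le0 //.
    by rewrite opprB addrC subrK mul1r.
  move=> x y cx cy; case: asboolP => rx; case: asboolP => ry.
  + by rewrite -opprD normrN capped_dist_lip.
  + by rewrite -opprD normrN sep.
  + by rewrite opprK addrC [leRHS]distrC sep.
  + exact: capped_dist_lip.
- by move=> x; case: ifP => _ gx; apply: capped_dist_eq0 => //; apply: oppr_inj; rewrite ?oppr0 -?gx ?opprK.
- move=> x cx x0; case: asboolP => [_|rx]; first by rewrite oppr_le0 capped_dist_ge0.
  have [Sx|Sx] := pselect (S x).
    by have := capped_dist_le x Sx; rewrite subrr normr0.
  by case: rx; exists (fun=> x); split=> // t; exact: cvg_cst.
- move=> x cx x1; case: asboolP => [[g [cg gS g0 g1]]|_]; last exact: capped_dist_ge0.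
  have [||t St] := S_cuts cg _ g0; first by move=> t; exact: (gS t).1.
    by rewrite g1.
  by have := (gS t).2.
Qed.
End CuttingFunction.

(** * Generic perturbation of maps on low-dimensional sets *)

Section GeneralPosition.
Variables (R : realFieldType) (m q : nat).

(** A nonzero polynomial has fewer roots than its size, so they cannot include all of [B], [B + 1],
    and so on, [size p] numbers in total. *)
Lemma exists_large_nonroot (p : {poly R}) B :
  p != 0 -> exists2 s, B <= s & ~~ root p s.
Proof.
move=> p0; pose rs := [seq B + k%:R | k <- iota 0 (size p)].
have [|/allPn[s /mapP[k _ ->] ps]] := boolP (all (root p) rs); last first.
  by exists (B + k%:R); rewrite // lerDl.
move=> /(max_poly_roots p0); rewrite size_map size_iota ltnn => H.
suff : uniq rs by move=> /H.
by rewrite map_inj_uniq ?iota_uniq // => i j /addrI /eqP; rewrite eqr_nat => /eqP.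
Qed.

(* The points w j are moved along the moment curve; with the perturbation
   written as u j / s, independence fails only when s is a root of one of
   finitely many polynomials, nonzero since their value at 0 is a Vandermonde
   determinant. *)
Lemma general_position (w : 'I_q -> 'rV[R]_m) (e : R) : 0 < e ->
  exists v : 'I_q -> 'rV[R]_m, (forall j, `|v j - w j| < e) /\
    forall c : 'I_q -> R, (#|[set j | c j != 0%R]%SET| <= m)%N ->
    \sum_j c j *: v j = 0 -> forall j, c j = 0.
Proof.
move=> e0; pose u (j : 'I_q) : 'rV[R]_m := \row_b (j%:R ^+ b).
(* Coordinates from [m] on are read as 0, so that [M A] is a square matrix for every [A]. *)
pose ext (x : 'rV[R]_m) (b : nat) := oapp (x ord0) 0 (insub b).
pose M (A : {set 'I_q}) : 'M[{poly R}]_#|A| := \matrix_(a, b)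
  (((enum_val a : 'I_q)%:R ^+ b)%:P + 'X * (ext (w (enum_val a)) b)%:P).
have M0 A : \det (M A) != 0.
  apply: contraTneq isT => /(congr1 (fun p => p.[0])).
  rewrite -horner_evalE -det_map_mx horner0.
  pose x : 'rV[R]_#|A| := \row_a (enum_val a : 'I_q)%:R.
  have -> : map_mx (horner_eval 0) (M A) = (Vandermonde #|A| x)^T.
    by apply/matrixP => a b; rewrite !mxE /horner_eval !hornerE.
  rewrite det_tr det_Vandermonde => /eqP; rewrite prodf_seq_eq0 => /hasP[a _] /=.
  rewrite prodf_seq_eq0 => /hasP[b _] /= /andP[ab].
  rewrite !mxE subr_eq0 eqr_nat => /eqP/val_inj/enum_val_inj ba.
  by rewrite ba ltnn in ab.
have P0 : \prod_(A : {set 'I_q}) \det (M A) != 0 by apply/prodf_neq0 => A _; exact: M0.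
pose C := \sum_j `|u j|.
have C0 : 0 <= C by apply: sumr_ge0.
(* The bound makes [s^-1 *: u j] shorter than [e]; not being a root of the product makes all
   determinants nonzero at [s]. *)
have [s sB /negP sP] := exists_large_nonroot (C / e + 1) P0.
have s0 : 0 < s by rewrite (lt_le_trans _ sB) // ltr_wpDl ?ltr01 // divr_ge0 // ltW.
exists (fun j => w j + s^-1 *: u j); split=> [j|c cA cv].
  rewrite addrC addKr normrZ gtr0_norm ?invr_gt0 // mulrC ltr_pdivrMr //.
  have uC : `|u j| <= C by rewrite /C (bigD1 j) //= lerDl sumr_ge0.
  rewrite (le_lt_trans uC) // -ltr_pdivrMl // mulrC (lt_le_trans _ sB) //.
  by rewrite ltrDl.
have {}cv : \sum_j c j *: (u j + s *: w j) = 0.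
  have := congr1 (fun z => s *: z) cv; rewrite scaler0 scaler_sumr => sv.
  rewrite -[RHS]sv; apply: eq_bigr => j _.
  rewrite scalerA mulrC -scalerA; congr (_ *: _).
  by rewrite scalerDr scalerA mulfV ?gt_eqF // scale1r addrC.
pose A := [set j | c j != 0]%SET.
pose D : 'M[R]_#|A| := map_mx (horner_eval s) (M A).
have uD : D \in unitmx.
  rewrite unitmxE unitfE det_map_mx; apply/negP => /eqP sA; apply: sP.
  by rewrite rootE horner_prod (bigD1 A) //= -[X in X * _]horner_evalE sA mul0r.
pose r : 'rV[R]_#|A| := \row_a c (enum_val a).
(* These are the first [#|A|] coordinates of the relation; they exist because the support [A] of [c]
   has at most [m] elements. *)
have rD : r *m D = 0.
  apply/rowP => b; rewrite !mxE.
  have bm : (b < m)%N := leq_trans (ltn_ord b) cA.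
  have := congr1 (fun z : 'rV[R]_m => z ord0 (Ordinal bm)) cv.
  rewrite mxE summxE => cvb; rewrite -[RHS]cvb.
  rewrite [RHS](bigID (mem A)) /= [X in _ = _ + X]big1 ?addr0; last first.
    by move=> j; rewrite inE negbK => /eqP ->; rewrite scale0r mxE.
  rewrite [RHS]big_enum_val; apply: eq_bigr => a _.
  by rewrite !mxE /horner_eval !hornerE /ext insubT /=.
have {rD} r0 : r = 0 by rewrite -[r](mulmxK uD) rD mul0mx.
move=> j; apply/eqP/negPn/negP => cj.
have jA : j \in A by rewrite inE.
have /eqP := congr1 (fun z : 'rV[R]_#|A| => z ord0 (enum_rank_in jA j)) r0.
by rewrite !mxE enum_rankK_in // (negbTE cj).
Qed.
End GeneralPosition.

Lemma continuous_sum (R : realType) (T : topologicalType) (V : normedModType R)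
    n (f : 'I_n -> T -> V) :
  (forall i, continuous (f i)) -> continuous (fun x => \sum_i f i x).
Proof. by move=> cf; apply: continuous_big => //; exact: add_continuous. Qed.

Lemma continuous_scale (R : realType) (T : topologicalType) (V : normedModType R)
    (a : T -> R) (f : T -> V) :
  continuous a -> continuous f -> continuous (fun x => a x *: f x).
Proof. by move=> ca cf x; apply: cvgZ; [exact: ca|exact: cf]. Qed.

Lemma continuous_add (R : realType) (T : topologicalType) (V : normedModType R)
    (f g : T -> V) :
  continuous f -> continuous g -> continuous (fun x => f x + g x).
Proof. by move=> cf cg x; apply: cvgD; [exact: cf|exact: cg]. Qed.

Lemma continuous_sub (R : realType) (T : topologicalType) (V : normedModType R)
    (f g : T -> V) :
  continuous f -> continuous g -> continuous (fun x => f x - g x).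
Proof. by move=> cf cg x; apply: cvgB; [exact: cf|exact: cg]. Qed.

Lemma continuous_mul (R : realType) (T : topologicalType) (a b : T -> R) :
  continuous a -> continuous b -> continuous (fun x => a x * b x).
Proof. by move=> ca cb x; apply: cvgM; [exact: ca|exact: cb]. Qed.

Lemma continuous_norm (R : realType) (T : topologicalType) (V : normedModType R)
    (f : T -> V) : continuous f -> continuous (fun x => `|f x|).
Proof. by move=> cf x; apply: cvg_norm; exact: cf. Qed.

Lemma continuous_inv (R : realType) (T : topologicalType) (a : T -> R) :
  (forall x, a x != 0) -> continuous a -> continuous (fun x => (a x)^-1).
Proof. by move=> a0 ca x; apply: cvgV; [exact: a0|exact: ca]. Qed.

Lemma continuous_maxr (R : realType) (T : topologicalType) (f g : T -> R) :
  continuous f -> continuous g -> continuous (fun x => Num.max (f x) (g x)).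
Proof. by move=> cf cg x; apply: (@continuous_max R T f g); [exact: cf|exact: cg]. Qed.

Lemma compact_pos_lower_bound (R : realType) (T : topologicalType) (C : set T)
    (f : T -> R) : compact C -> continuous f -> (forall x, C x -> 0 < f x) ->
  exists2 e, 0 < e & forall x, C x -> e <= f x.
Proof.
move=> cC cf f0; have [->|/set0P C0] := eqVneq C set0; first by exists 1.
have [x /set_mem Cx xmin] := @compact_EVT_min T R f C C0 cC (continuous_subspaceT cf).
by exists (f x) => [|y Cy]; [exact: f0|apply: xmin; exact: mem_set].
Qed.

Lemma compact_finite_net (R : realType) (T : ptopologicalType)
    (W : normedModType R) (C : set T) (f : T -> W) e :
    compact C -> continuous f -> 0 < e ->
  exists p (c : 'I_p -> W), forall x, C x -> exists i, `|c i - f x| < e.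
Proof.
move=> cC cf e0; move: cC; rewrite compact_cover => cC.
have [||D _ CD] := cC T setT (fun y => f @^-1` ball (f y) e).
- by move=> y _; apply: open_comp (ball_open _ _) => // x _; exact: cf.
- by move=> y _; exists y => //=; exact: ballxx.
pose r := in_tuple (finmap.enum_fset D).
exists (size (finmap.enum_fset D)), (fun i => f (tnth r i)) => x /CD[y /= yD].
rewrite -ball_normE /= => fxy.
by have /seq_tnthP[i ri] := yD; exists i; rewrite /r -ri.
Qed.

(* g is a partition of unity combination of points in general position, at most
   k + 1 of them at a time; w is one more point in general position with them. *)
Lemma low_dim_approximation (R : realType) N m (K Y C : set 'rV[R]_N) (k : int)
    (f : 'rV[R]_N -> 'rV[R]_m) (e : R) :
    compact K -> Y `<=` K -> compact C -> C `<=` Y -> covdim_le Y k ->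
    continuous f -> 0 < e ->
  exists (g : 'rV[R]_N -> 'rV[R]_m) (w : 'rV[R]_m),
    [/\ continuous g, forall x, C x -> `|g x - f x| < e,
      forall x a b, C x -> k + 1 + (b != 0)%:Z <= m%:Z ->
        a *: g x + b *: w = 0 -> a = 0 /\ b = 0 &
      (0 < m)%N -> w != 0].
Proof.
move=> cK YK cC CY [_ dimY] cf e0; have e3 : 0 < e / 3 by rewrite divr_gt0.
have [p [c cP]] := compact_finite_net cK cf e3.
have [i|x Yx|q [U [oU YU Uref Uord]]] := dimY p (fun i => [set x | `|c i - f x| < e / 3]).
- have -> : [set x | `|c i - f x| < e / 3] = f @^-1` ball (c i) (e / 3).
    by rewrite -ball_normE.
  by apply: open_comp (ball_open _ _) => // x _; exact: cf.
- by have [i ci] := cP x (YK x Yx); exists i.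
have /choice[r rP] := Uref.
(* The index [ord_max] yields [w], a perturbation of 0; the others yield the values attached to the
   sets [U j], close to net points. *)
have [v [vr vfree]] := general_position
  (fun j => if unlift ord_max j is Some i then c (r i) else 0) e3.
pose v' j := v (lift ord_max j).
pose d j := capped_dist (~` U j).
have cU j : closed (~` U j) by apply: open_closedC.
have d0 j x : 0 <= d j x by apply: capped_dist_ge0.
have dU j x : d j x != 0 -> U j x.
  move=> dj; apply: contrapT => Ux; move/eqP: dj; apply; apply/eqP.
  rewrite eq_le d0 andbT (le_trans (capped_dist_le (a := x) _ _)) //.
  by rewrite subrr normr0.
pose D x := \sum_j d j x.
have cD : continuous D.
  by apply: (@continuous_sum R _ R^o) => j; exact: capped_dist_continuous.
have D0 x : C x -> 0 < D x.
  move=> /CY/YU[j _ Ux]; rewrite /D (bigD1 j) //= ltr_pwDl ?sumr_ge0 //.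
  by apply: capped_dist_gt0 => //; exact.
have [eta eta0 Deta] := compact_pos_lower_bound cC cD D0.
(* On [C] the denominator is [D x]; the maximum with [eta] keeps the quotient continuous where [D]
   vanishes. *)
exists (fun x => (Num.max eta (D x))^-1 *: \sum_j d j x *: v' j), (v ord_max).
have gE x : C x -> (Num.max eta (D x))^-1 = (D x)^-1.
  by move=> /Deta /max_idPr ->.
split.
- apply: (@continuous_scale R _ 'rV[R]_m).
    apply: continuous_inv => [x|]; first by rewrite gt_eqF // lt_max eta0.
    by apply: continuous_maxr; [exact: cst_continuous|exact: cD].
  apply: (@continuous_sum R _ 'rV[R]_m) => j.
  apply: (@continuous_scale R _ 'rV[R]_m); last exact: cst_continuous.
  exact: capped_dist_continuous.
- move=> x Cx; rewrite gE //; have Dx := D0 x Cx.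
  have -> : f x = (D x)^-1 *: \sum_j d j x *: f x.
    by rewrite -scaler_suml scalerA mulVf ?gt_eqF // scale1r.
  rewrite -scalerBr -sumrB normrZ gtr0_norm ?invr_gt0 // mulrC ltr_pdivrMr //.
  (* Only sets [U j] containing [x] contribute. There [v' j] is within [e / 3] of a net point,
     itself within [e / 3] of [f x]. *)
  rewrite (@le_lt_trans _ _ (\sum_j d j x * (e / 3 + e / 3))) //; last first.
    rewrite -mulr_suml -/(D x) mulrC ltr_pM2r //; lra.
  rewrite (le_trans (ler_norm_sum _ _ _)) // ler_sum // => j _.
  rewrite -scalerBr normrZ ger0_norm //.
  have [->|dj] := eqVneq (d j x) 0; first by rewrite !mul0r.
  rewrite ler_wpM2l // -[v' j - _](subrKA (c (r j))).
  rewrite (le_trans (ler_normD _ _)) // lerD // ltW //.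
    by have := vr (lift ord_max j); rewrite liftK.
  exact: (rP j x (conj (CY x Cx) (dU _ _ dj))).
- move=> x a b Cx kb ab0; have Dx := D0 x Cx.
  pose z (j : 'I_q.+1) := if unlift ord_max j is Some i then a * (D x)^-1 * d i x else b.
  (* At most [k + 1] of the sets [U j] contain [x], and [b] adds at most one coefficient, so at most
     [m] are nonzero. *)
  have z0 : forall j, z j = 0.
    apply: vfree.
      rewrite -lez_nat (le_trans _ kb) // (@le_trans _ _
        (#|[pred j | `[< U j x >]]| + (b != 0%R))%N%:Z) //; last first.
        by rewrite PoszD lerD2r Uord //; exact: CY.
      rewrite lez_nat.
      pose A := [set lift ord_max j | j in [pred j | `[< U j x >]]]%SET.
      pose E := (if b != 0 then [set (ord_max : 'I_q.+1)] else finset.set0)%SET.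
      have /subset_leq_card/leq_trans : [set j | z j != 0]%SET \subset (A :|: E)%SET.
        apply/fintype.subsetP => j; rewrite !inE /z; case: unliftP => [i' ->|->].
          move=> az; apply/orP; left; apply/imsetP; exists i' => //.
          by rewrite inE; apply: dU; apply: contra_neq az => ->; rewrite mulr0.
        by rewrite /E => ->; rewrite inE eqxx orbT.
      apply; rewrite (leq_trans (leq_card_setU _ _)) // leq_add ?leq_imset_card //.
      by rewrite /E; case: ifP; rewrite ?cards1 ?cards0.
    rewrite -[RHS]ab0 big_ord_recr /= {2}/z unlift_none; congr (_ + _).
    rewrite gE // scalerA scaler_sumr; apply: eq_bigr => j _.
    have jE : widen_ord (leqnSn q) j = lift ord_max j.
      by apply: val_inj; exact/esym/lift_max.
    by rewrite /z jE liftK scalerA.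
  split; last by have := z0 ord_max; rewrite /z unlift_none.
  have : \sum_j z (lift ord_max j) = a.
    under eq_bigr do rewrite /z liftK.
    by rewrite -mulr_sumr -/(D x) -mulrA mulVf ?gt_eqF // mulr1.
  by move=> <-; rewrite big1.
- move=> m0; apply/eqP => w0.
  suff : (ord_max == ord_max :> 'I_q.+1)%:R = 0 :> R.
    by rewrite eqxx => /eqP; rewrite oner_eq0.
  apply: (vfree (fun j => (j == ord_max)%:R)).
    rewrite (leq_trans _ m0) // -(cards1 (ord_max : 'I_q.+1)) subset_leq_card //.
    apply/fintype.subsetP => j; rewrite !inE.
    by case: (j == ord_max); rewrite ?eqxx.
  rewrite big_ord_recr /= eqxx w0 scaler0 addr0 big1 // => j _.
  by rewrite -val_eqE /= ltn_eqF // scale0r.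
Qed.

(** * Extension of maps *)

Lemma continuous_row (R : realType) (T : topologicalType) m
    (f : 'I_m -> T -> R) :
  (forall j, continuous (f j)) -> continuous (fun x => \row_j f j x).
Proof.
move=> cf; rewrite (_ : (fun x => _) = fun x => \sum_j f j x *: delta_mx ord0 j).
  apply: (@continuous_sum R T 'rV[R]_m) => j.
  by apply: (@continuous_scale R T 'rV[R]_m); [exact: cf|exact: cst_continuous].
by apply/funext => x; rewrite [LHS]row_sum_delta; apply: eq_bigr => j _; rewrite mxE.
Qed.

Lemma within_continuous_comp (T U V : topologicalType) (A : set T)
    (f : T -> U) (g : U -> V) : {within A, continuous f} -> continuous g ->
  {within A, continuous (g \o f)}.
Proof. by move=> cf cg x B gB; exact: (cf x (g @^-1` B) (cg _ _ gB)). Qed.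

Lemma closed_setX (T U : topologicalType) (A : set T) (B : set U) :
  closed A -> closed B -> closed (A `*` B).
Proof.
move=> cA cB; rewrite (_ : A `*` B = fst @^-1` A `&` snd @^-1` B) //.
apply: closedI; apply: preimage_closed => //.
  by move=> x _; exact: cvg_fst.
by move=> x _; exact: cvg_snd.
Qed.

Lemma closed_fiber (R : realType) (T : topologicalType) (V : normedModType R)
    (f : T -> V) y : continuous f -> closed [set x | f x = y].
Proof.
move=> cf; rewrite (_ : mkset _ = f @^-1` [set y]) //.
apply: preimage_closed => [x _|]; first exact: cf.
apply: accessible_closed_set1.
exact/hausdorff_accessible/norm_hausdorff.
Qed.

(** The bounded Tietze theorem is applied to each coordinate, compactness of [A] giving the
    bound. *)
Lemma tietze_compact (R : realType) (T : pseudoMetricType R) (A : set T) m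
    (f : T -> 'rV[R]_m) :
  closed A -> compact A -> {within A, continuous f} ->
  exists2 g, continuous g & forall x, A x -> g x = f x.
Proof.
move=> cA kA cf.
have ext j : exists g : T -> R, continuous g /\ forall x, A x -> g x = f x ord0 j.
  have cfj : {within A, continuous (fun x => f x ord0 j)}.
    exact: within_continuous_comp cf (@coord_continuous _ _ _ ord0 j).
  have /compact_bounded[M [Mreal Mf]] := continuous_compact cfj kA.
  have M1 : M < `|M| + 1 by rewrite (le_lt_trans (ler_norm M)) // ltrDl.
  have [||g [fg cg _]] := continuous_bounded_extension (pseudometric_normal (X := T)) cA (M := `|M| + 1) _ cfj.
  - by rewrite ltr_wpDl.
  - by move=> x Ax; apply: (Mf _ M1); exists x.
  by exists g; split=> // x Ax; rewrite fg ?inE.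
have /choice[g gP] := ext.
exists (fun x => \row_j g j x) => [|x Ax].
  by apply: continuous_row => j; exact: (gP j).1.
by apply/rowP => j; rewrite mxE (gP j).2.
Qed.

(** [H] over [B] and [f] on the top level 1 glue to a map on a closed set, extended by Tietze to
    some [G]. Zeros of [G] over [K] stay away from [B], so a cutoff can bypass them. *)
Lemma borsuk_extension (R : realType) N m (K B : set 'rV[R]_N)
    (H : R * 'rV[R]_N -> 'rV[R]_m) (f : 'rV[R]_N -> 'rV[R]_m) :
    compact K -> closed B -> B `<=` K ->
    {within `[0, 1] `*` B, continuous H} ->
    (forall t x, 0 <= t <= 1 -> B x -> H (t, x) != 0) ->
    continuous f -> (forall x, K x -> f x != 0) ->
    (forall x, B x -> H (1, x) = f x) ->
  exists2 g : 'rV[R]_N -> 'rV[R]_m, continuous g & (forall x, K x -> g x != 0) /\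
     forall x, B x -> g x = H (0, x).
Proof.
move=> kK cB BK cH H0 cf f0 Hf.
have cK : closed K by apply: compact_closed kK; exact: norm_hausdorff.
have kB : compact B by exact: subclosed_compact cB kK BK.
have kI : compact `[(0:R), 1] by exact: segment_compact.
have cI : closed `[(0:R), 1] by exact: interval_closed.
pose A := (`[(0:R), 1] `*` B) `|` ([set 1] `*` K).
have cA1 : closed (`[(0:R), 1] `*` B) by exact: closed_setX.
have cA2 : closed ([set (1 : R)] `*` K) 
  by apply: closed_setX => //; apply: (@closed_fiber R R R^o id) => x; exact: cvg_id.
have kA : compact A.
  apply: subclosed_compact (closedU cA1 cA2) (compact_setX kI kK) _.
  move=> [t x] [[/= t01 Bx]|[/= -> Kx]]; split=> //=; first exact: BK.
  by rewrite in_itv /= lexx ler01.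
pose h (z : R * 'rV[R]_N) := if `[< z.1 = 1 >] then f z.2 else H z.
have ch : {within A, continuous h}.
  apply: withinU_continuous => //.
    apply: (subspace_eq_continuous (f := H)) => // -[t x] /set_mem[/= _ Bx].
    by rewrite /from_subspace /h /=; case: asboolP => [->|//]; rewrite Hf.
  apply: (subspace_eq_continuous (f := f \o snd)).
    by move=> [t x] /set_mem[/= -> _]; rewrite /from_subspace /h /=; case: asboolP.
  apply: continuous_subspaceT => z; apply: continuous_comp; first exact: cvg_snd.
  exact: cf.
(* G (mu x, x), where mu is 0 on B and 1 on the points of K over which G has a
   zero, is the required map. *)
have [G cG GA] := tietze_compact (closedU cA1 cA2) kA ch.
have csnd : continuous (@snd R 'rV[R]_N) by move=> z; exact: cvg_snd.
pose Z := snd @` ((`[(0:R), 1] `*` K) `&` [set z | G z = 0]).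
have cG0 : closed [set z | G z = 0] by exact: closed_fiber.
have kZ : compact Z.
  apply: continuous_compact; first exact: continuous_subspaceT csnd.
  apply: subclosed_compact (compact_setX kI kK) (@subIsetl _ _ _).
  by apply: closedI => //; exact: closed_setX.
(* Over [B] the map [G] takes only values of [H] or [f], none of them 0. *)
have Zpos x : Z x -> 0 < capped_dist B x.
  move=> [[t y] [[/= t01 Ky] G0] <- /=]; apply: capped_dist_gt0 => // By.
  have Aty : A (t, y) by left.
  have := GA _ Aty; rewrite G0 /h /=; case: asboolP => _ /esym/eqP; apply/negP.
    exact: f0.
  by apply: H0; rewrite // -in_itv.
have [e e0 eZ] := compact_pos_lower_bound kZ (@capped_dist_continuous _ _ B) Zpos.
pose mu x := clamp01 (capped_dist B x / e).
have cmu : continuous mu.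
  move=> x; apply: (@continuous_comp _ _ _ (fun x => capped_dist B x / e) (@clamp01 R)).
    move: x; apply: continuous_mul; last exact: cst_continuous.
    exact: capped_dist_continuous.
  exact: clamp01_continuous.
exists (fun x => G (mu x, x)); last split.
- move=> x; apply: (@continuous_comp _ _ _ (fun x => (mu x, x)) G); last exact: cG.
  exact: cvg_pair (cmu x) cvg_id.
- move=> x Kx; apply/eqP => Gx.
  have Zx : Z x.
    exists (mu x, x) => //; split=> //; split=> //=; rewrite in_itv /=.
    exact: clamp01_itv.
  have mu1 : mu x = 1 by apply: clamp01_ge1; rewrite ler_pdivlMr // mul1r; exact: eZ.
  have Ax : A (1, x) by right.
  by move: Gx; rewrite mu1 GA // /h /=; case: asboolP => // _; apply/eqP; exact: f0.
- move=> x Bx.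
  have -> : mu x = 0.
    apply: clamp01_le0; rewrite pmulr_lle0 ?invr_gt0 //.
    by rewrite (le_trans (capped_dist_le _ Bx)) // subrr normr0.
  have Ax : A (0, x) by left; split=> //=; rewrite in_itv /= lexx ler01.
  by rewrite GA // /h /=; case: asboolP => // /esym/eqP; rewrite oner_eq0.
Qed.

(** * Linking sets *)

Section CubeLinking.
Variables (R : realType) (N : nat) (J : {set 'I_N}).
Local Notation V := 'rV[R]_N.
Local Notation W := 'rV[R]_#|(~: J)%SET|.
Local Notation proj := (@centered_proj R N J).

(* On the cube |x_j - 1/2| <= 1/2 with equality exactly when x_j is 0 or 1, so
   this is the union of the faces x_j = 0 and x_j = 1 with j not in J. *)
Definition side : set V := [set x | cube x /\ 2^-1 <= `|proj x|].

(* Requiring f to be defined on the whole space, with prescribed values on all of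
   side, makes the property pass to intersections of chains. *)
Definition linking (K : set V) := forall f : V -> W, continuous f ->
  (forall x, side x -> f x = proj x) -> exists2 x, K x & f x = 0.

Lemma proj_continuous : continuous proj.
Proof.
apply: continuous_row => j; apply: (@continuous_sub R V R^o).
  exact: coord_continuous.
exact: cst_continuous.
Qed.

Lemma norm_proj_continuous : continuous (fun x => `|proj x|).
Proof. exact: (@continuous_norm R V W) proj_continuous. Qed.

Lemma side_closed : closed side.
Proof.
rewrite (_ : side = @cube R N `&` (fun x => `|proj x|) @^-1` [set t | 2^-1 <= t]) //.
apply: closedI; first exact: cube_closed.
by apply: preimage_closed => [x _|]; [exact: norm_proj_continuous|exact: closed_ge].
Qed.

Lemma side_compact : compact side.
Proof. by apply: subclosed_compact side_closed (@cube_compact R N) _ => x []. Qed.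

Lemma side_proj_neq0 x : side x -> proj x != 0.
Proof.
by case=> _; apply: contraTneq => ->; rewrite normr0 -ltNge invr_gt0.
Qed.

Lemma face_side x k : k \notin J -> cube x -> x ord0 k = 0 \/ x ord0 k = 1 -> side x.
Proof.
move=> kJ cx xk; split=> //.
have kC : k \in (~: J)%SET by rewrite inE.
rewrite (le_trans _ (coord_norm_le _ (enum_rank_in kC k))) // mxE enum_rankK_in //.
by case: xk => ->; rewrite ler_normr; apply/orP; [right|left]; lra.
Qed.

(** A coordinate attaining the norm of [proj x] is at distance at least 1/2 from 1/2; pushing it
    further out leaves the cube at once. *)
Lemma side_boundary : side `<=` @cube_boundary R N.
Proof.
move=> x [cx px]; split; first exact: subset_closure.
have p0 : `|proj x| != 0 by rewrite gt_eqF // (lt_le_trans _ px) // invr_gt0.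
have [[i k] /= xk] : exists i, `|proj x| = `|proj x i.1 i.2|.
  by apply: mx_norm_neq0.
rewrite ord1 mxE in xk; set j := enum_val k in xk.
move=> /nbhs_ballP[e /= e0 eC].
have e2 : 0 < e / 2 by rewrite divr_gt0.
pose s : R := if x ord0 j < 2^-1 then -1 else 1.
have ns : `|s| = 1 by rewrite /s; case: ifP; rewrite ?normrN normr1.
have cy : cube (x + (s * (e / 2)) *: delta_mx ord0 j).
  apply: eC; rewrite -ball_normE /= opprD addrA subrr add0r normrN normrZ normrM ns.
  rewrite mul1r gtr0_norm // (@le_lt_trans _ _ (e / 2)) //; last lra.
  rewrite ger_pMr // rV_norm_le // => i'; rewrite !mxE eqxx /=.
  by case: (i' == j); rewrite ?normr1 ?normr0.
have := cy j; have := cx j; rewrite !mxE !eqxx mulr1; move: px; rewrite xk /s.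
case: ltP => xj; rewrite ler_normr => /orP; lra.
Qed.

(** Poincare-Miranda is applied to the cutting functions for [k] in [J] and to the components of [f]
    for the other [k], which on their faces equal -1/2 and 1/2 like those of [proj]. *)
Lemma linking_intersection (S : 'I_N -> set V) :
    (forall j, j \in J -> closed (S j)) ->
    (forall j, j \in J -> forall gamma : R -> V, continuous gamma ->
      (forall t, cube (gamma t)) -> gamma 0 ord0 j = 0 -> gamma 1 ord0 j = 1 ->
      exists t, S j (gamma t)) ->
  linking [set x | cube x /\ forall j, j \in J -> S j x].
Proof.
move=> cS cutS f cf fs.
have /choice[g gP] : forall j, exists g : V -> R, j \in J ->
   [/\ forall x y, cube x -> cube y -> `|g x - g y| <= `|x - y|,
      forall x, g x = 0 -> S j x,
      forall x, cube x -> x ord0 j = 0 -> g x <= 0 &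
      forall x, cube x -> x ord0 j = 1 -> 0 <= g x].
  move=> j; have [jJ|] := boolP (j \in J); last by exists (fun=> 0).
  by have [g] := cutting_function (cS j jJ) (cutS j jJ); exists g.
pose F k x := if [pick b | enum_val b == k] is Some b then f x ord0 b else g k x.
have FJ k : k \in J -> F k = g k.
  move=> kJ; apply/funext => x; rewrite /F; case: pickP => // b /eqP bk.
  by have := enum_valP b; rewrite bk inE kJ.
have FC b : F (enum_val b) = fun x => f x ord0 b.
  apply/funext => x; rewrite /F; case: pickP => [c /eqP/enum_val_inj ->//|].
  by move=> /(_ b); rewrite eqxx.
have FCk k : k \notin J -> exists b : 'I_#|(~: J)%SET|, k = enum_val b.
  move=> kJ; have kC : k \in (~: J)%SET by rewrite inE.
  by exists (enum_rank_in kC k); rewrite enum_rankK_in.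
have [|||x cx Fx] := @poincare_miranda R N F.
- move=> k; have [kJ|/FCk[b ->]] := boolP (k \in J); last first.
    rewrite FC; apply: continuous_subspaceT => x.
    by apply: (@continuous_comp V W R f (fun y => y ord0 b)); [exact: cf|exact: coord_continuous].
  rewrite FJ //; apply/within_continuousP => x B cx /nbhs_ballP[e /= e0 eB].
  apply/nbhs_ballP; exists e => //= y; rewrite -ball_normE /= => xy cy.
  apply: eB; rewrite -ball_normE /=; apply: le_lt_trans xy.
  by have [+ _ _ _] := gP k kJ; apply.
- move=> k x cx xk; have [kJ|kJ] := boolP (k \in J).
    by rewrite FJ //; have [_ _ + _] := gP k kJ; apply.
  have := face_side kJ cx (or_introl xk); have [b kb] := FCk k kJ => sx.
  by rewrite kb FC fs // mxE -kb xk; lra.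
- move=> k x cx xk; have [kJ|kJ] := boolP (k \in J).
    by rewrite FJ //; have [_ _ _ +] := gP k kJ; apply.
  have := face_side kJ cx (or_intror xk); have [b kb] := FCk k kJ => sx.
  by rewrite kb FC fs // mxE -kb xk; lra.
exists x; first split=> // j jJ.
  by have [_ + _ _] := gP j jJ; apply; rewrite -FJ.
by apply/rowP => b; rewrite mxE; have := Fx (enum_val b); rewrite FC.
Qed.

(** Agreement with [proj] on the part of [side] in [K] suffices: [f] on [K] and [proj] on [side]
    glue and extend by Tietze. *)
Lemma linking_zero K : compact K -> linking K -> forall f : V -> W,
  continuous f -> (forall x, K x -> side x -> f x = proj x) ->
  exists2 x, K x & f x = 0.
Proof.
move=> kK lK f cf fs.
have cK : closed K by apply: compact_closed kK; exact: norm_hausdorff.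
pose h x := if `[< K x >] then f x else proj x.
have ch : {within K `|` side, continuous h}.
  apply: withinU_continuous => //; first exact: side_closed.
    apply: (subspace_eq_continuous (f := f)); last exact: continuous_subspaceT.
    by move=> x /set_mem Kx; rewrite /from_subspace /h; case: asboolP.
  apply: (subspace_eq_continuous (f := proj)); last first.
    exact: continuous_subspaceT proj_continuous.
  move=> x /set_mem sx; rewrite /from_subspace /h; case: asboolP => // Kx.
  by rewrite fs.
have cKs : closed (K `|` side) by apply: closedU => //; exact: side_closed.
have kKs : compact (K `|` side).
  exact: compactU kK side_compact.
have [g cg gh] := tietze_compact cKs kKs ch.
have [|x Kx gx0] := lK g cg; last first.
  by exists x => //; rewrite -gx0 gh; [rewrite /h; case: asboolP|left].
move=> x sx; rewrite gh; last by right.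
by rewrite /h; case: asboolP => // Kx; exact: fs.
Qed.

Lemma linking_nonempty K : linking K -> K !=set0.
Proof. by case/(_ proj proj_continuous (fun _ _ => erefl)) => x Kx _; exists x. Qed.

(** * Minimal linking sets *)

Definition minimal_linking (K : set V) :=
  [/\ compact K, linking K &
    forall A, closed A -> A `<=` K -> linking A -> K `<=` A].

Lemma exists_minimal_linking K : compact K -> linking K ->
  exists2 A, A `<=` K & minimal_linking A.
Proof.
move=> kK lK.
have cK : closed K by apply: compact_closed kK; exact: norm_hausdorff.
(* Zorn's lemma is used for unions of chains, hence applied to the sets removed from [K]. *)
pose P (B : set V) := closed (K `\` B) /\ linking (K `\` B).
have [F FP Ftot|B [[cB lB] Bmax]] := @Zorn_bigcup V P; last first.
  exists (K `\` B); first exact: subDsetl.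
  split=> // [|A cA AKB lA x KBx].
    by apply: subclosed_compact cB kK _; exact: subDsetl.
  apply: contrapT => Ax; apply: (Bmax (~` A)).
    split=> [y By|]; first by move=> /AKB[].
    by move=> AB; exact: KBx.2 (AB x Ax).
  rewrite /P (_ : K `\` ~` A = A) //.
  apply/seteqP; split=> y; first by move=> [_ /contrapT].
  by move=> Ay; split; [exact: (AKB y Ay).1|move=> /(_ Ay)].
have [->|/set0P[B0 FB0]] := eqVneq F set0.
  by rewrite bigcup_set0 /P setD0.
have KF : K `\` \bigcup_(B in F) B = \bigcap_(B in F) (K `\` B).
  apply/seteqP; split=> [x [Kx Fx] B FB|x Fx].
    by split=> // Bx; apply: Fx; exists B.
  by split; [exact: (Fx B0 FB0).1|move=> [B FB Bx]; exact: (Fx B FB).2].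
rewrite /P KF; split; first by apply: closed_bigI => B /FP[].
(* For fixed [f], the zero sets on the members of the chain are nested, closed and nonempty; by
   compactness they have a common point. *)
move=> f cf fs; pose Z B := (K `\` B) `&` [set x | f x = 0].
have cZ B : F B -> closed (Z B).
  by move=> /FP[cB _]; apply: closedI => //; exact: closed_fiber.
have ZF : ProperFilter (filter_from F Z).
  apply: filter_from_proper; last first.
    by move=> B /FP[_ lB]; have [x Bx fx] := lB f cf fs; exists x.
  apply: filter_from_filter; first by exists B0.
  move=> A B FA FB; have [AB|BA] := Ftot A B FA FB.
    by exists B => // x [[Kx Bx] fx]; split; split=> //; split=> // /AB.
  by exists A => // x [[Kx Ax] fx]; split; split=> //; split=> // /BA.
have [|x [Kx xF]] := kK _ ZF; first by exists B0 => // x [[]].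
have ZFx B : F B -> Z B x.
  move=> FB; apply: (cZ B FB) => U Ux; apply: xF => //.
  by exists B.
by exists x; [move=> B /ZFx[]|exact: (ZFx B0 FB0).2].
Qed.

(** Otherwise a map without zeros on [A] and one without zeros on [B] could be interpolated by a
    cutoff that is 0 on [A] and 1 on [B]; both equal [proj] on [side], so the result does too. *)
Lemma linking_partition K A B : compact A -> compact B -> A `&` B = set0 ->
  K = A `|` B -> linking K -> linking A \/ linking B.
Proof.
move=> kA kB AB KE lK; apply: contrapT => /not_orP[nA nB].
have free C : ~ linking C -> exists f : V -> W, [/\ continuous f,
    forall x, side x -> f x = proj x & forall x, C x -> f x <> 0].
  move=> nC; apply: contrapT => nf; apply: nC => f cf fs.
  by apply: contrapT => fC; apply: nf; exists f; split=> // x Cx fx; apply: fC; exists x.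
have [f [cf fs fA]] := free A nA; have [g [cg gs gB]] := free B nB.
have cA : closed A by apply: compact_closed kA; exact: norm_hausdorff.
have Bpos x : B x -> 0 < capped_dist A x.
  move=> Bx; apply: capped_dist_gt0 => // Ax.
  by have : (A `&` B) x by []; rewrite AB.
have [e e0 eB] := compact_pos_lower_bound kB (@capped_dist_continuous _ _ A) Bpos.
pose mu x := clamp01 (capped_dist A x / e).
have cmu : continuous mu.
  move=> x; apply: (@continuous_comp _ _ _ (fun x => capped_dist A x / e) (@clamp01 R)).
    move: x; apply: continuous_mul; last exact: cst_continuous.
    exact: capped_dist_continuous.
  exact: clamp01_continuous.
have [||x] := lK (fun x => f x + mu x *: (g x - f x)).
- apply: (@continuous_add R V W) => //; apply: (@continuous_scale R V W) => //.
  exact: (@continuous_sub R V W).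
- by move=> x sx; rewrite gs // fs // subrr scaler0 addr0.
rewrite KE => -[Ax|Bx].
  have -> : mu x = 0.
    apply: clamp01_le0; rewrite pmulr_lle0 ?invr_gt0 //.
    by rewrite (le_trans (capped_dist_le _ Ax)) // subrr normr0.
  by rewrite scale0r addr0; exact: fA.
have -> : mu x = 1 by apply: clamp01_ge1; rewrite ler_pdivlMr // mul1r; exact: eB.
by rewrite scale1r addrC subrK; exact: gB.
Qed.

(** A relatively clopen [B] and its complement in [K] are compact, so one of them is linking.
    Minimality gives [B = K] in the first case and puts [b] outside [B] in the second. *)
Lemma minimal_linking_connected K : minimal_linking K -> connected K.
Proof.
move=> [kK lK Kmin] B [b Bb] [C oC BE] [D cD BE'].
have cK : closed K by apply: compact_closed kK; exact: norm_hausdorff.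
have cB : closed B by rewrite BE'; exact: closedI.
have BK : B `<=` K by rewrite BE; exact: subIsetl.
have KB : K `\` B = K `&` ~` C.
  by rewrite BE setDE setCI setIUr setICr set0U.
have cKB : closed (K `\` B) by rewrite KB; apply: closedI => //; exact: open_closedC.
have kB : compact B by exact: subclosed_compact cB kK BK.
have kKB : compact (K `\` B) by exact: subclosed_compact cKB kK (@subDsetl _ _ _).
have KBE : K = B `|` (K `\` B) by rewrite setDUK.
have [lB|lKB] := linking_partition kB kKB (setDIK B K) KBE lK.
- by apply/seteqP; split=> //; exact: Kmin.
- by have [_ []] := Kmin _ cKB (@subDsetl _ _ _) lKB b (BK b Bb).
Qed.

(** By minimality some admissible [f] has no zero on [K] outside [U]. If [k] were too small, pushing
    [f] towards a nonvanishing approximation where [f] is small would remove the remaining zeros. *)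
Lemma minimal_linking_dim K x (U Y : set V) (k : int) :
    minimal_linking K -> K `<=` @cube R N -> K x -> open U -> U x ->
    K `&` U `<=` Y -> Y `<=` K -> covdim_le Y k ->
  #|(~: J)%SET|%:Z <= k.
Proof.
move=> [kK lK Kmin] Kcube Kx oU Ux KUY YK dimY; rewrite leNgt; apply/negP => km.
have cK : closed K by apply: compact_closed kK; exact: norm_hausdorff.
have cKU : closed (K `\` U).
  by rewrite setDE; apply: closedI => //; exact: open_closedC.
have [f [cf fs fKU]] : exists f : V -> W, [/\ continuous f,
    forall y, side y -> f y = proj y & forall y, (K `\` U) y -> f y <> 0].
  apply: contrapT => nf.
  have lKU : linking (K `\` U).
    move=> f cf fs; apply: contrapT => fU; apply: nf; exists f; split=> // y Uy fy.
    by apply: fU; exists y.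
  by have [_ []] := Kmin _ cKU (@subDsetl _ _ _) lKU x Kx.
pose A := (K `\` U) `|` side.
have kA : compact A.
  apply: compactU side_compact.
  exact: subclosed_compact cKU kK (@subDsetl _ _ _).
have cnf : continuous (fun y => `|f y|) by exact: (@continuous_norm R V W).
have fA y : A y -> 0 < `|f y|.
  case=> [/fKU/eqP|sy]; first by rewrite normr_gt0.
  by rewrite fs // normr_gt0 side_proj_neq0.
have [d d0 dA] := compact_pos_lower_bound kA cnf fA.
pose e := d / 4; have e0 : 0 < e by rewrite divr_gt0.
(* f is moved towards g only where |f y| < 2 e, which on K happens only in Y. *)
pose C := K `&` [set y | `|f y| <= 2 * e].
have kC : compact C.
  apply: subclosed_compact kK (@subIsetl _ _ _); apply: closedI => //.
  rewrite (_ : mkset _ = (fun y => `|f y|) @^-1` [set t | t <= 2 * e]) //.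
  by apply: preimage_closed => [y _|]; [exact: cnf|exact: closed_le].
have CY : C `<=` Y.
  move=> y [Ky fy]; apply: KUY; split=> //; apply: contrapT => Uy.
  have Ay : A y by left.
  by have := le_trans (dA y Ay) fy; rewrite /e; lra.
have [g [w [cg gf gw _]]] := low_dim_approximation kK YK kC CY dimY cf e0.
have g0 y : C y -> g y != 0.
  move=> Cy; apply/eqP => gy0; have [] := gw y 1 0 Cy.
  - by rewrite eqxx addr0 lezD1.
  - by rewrite gy0 scaler0 scale0r addr0.
  - by move/eqP; rewrite oner_eq0.
pose la y := clamp01 (2 - `|f y| / e).
have cla : continuous la.
  move=> y; apply: (@continuous_comp _ _ _ (fun y => 2 - `|f y| / e) (@clamp01 R)).
    move: y; apply: (@continuous_sub R V R^o); first exact: cst_continuous.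
    by apply: continuous_mul => //; exact: cst_continuous.
  exact: clamp01_continuous.
have [||y Ky] := lK (fun y => f y + la y *: (g y - f y)).
- apply: (@continuous_add R V W) => //; apply: (@continuous_scale R V W) => //.
  exact: (@continuous_sub R V W).
- move=> y sy; have Ay : A y by right.
  rewrite /la clamp01_le0 ?scale0r ?addr0 ?fs // subr_le0 ler_pdivlMr //.
  by rewrite -fs // (le_trans _ (dA y Ay)) // /e; lra.
have [fy|fy] := leP (`|f y|) (2 * e); last first.
  rewrite /la clamp01_le0 ?scale0r ?addr0; last by rewrite subr_le0 ler_pdivlMr // ltW.
  by move=> fy0; move: fy; rewrite fy0 normr0 ltNge mulr_ge0 // ltW.
have Cy : C y by [].
(* Where [f] has norm at most [e] the new map is [g], nonzero on [C]; elsewhere on [C] it differs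
   from [f] by less than [e] and cannot reach 0. *)
have [fy'|fy'] := leP (`|f y|) e.
  rewrite /la clamp01_ge1 ?scale1r 1?addrC ?subrK; first by apply/eqP; exact: g0.
  have : `|f y| / e <= 1 by rewrite ler_pdivrMr // mul1r.
  lra.
move=> /eqP; rewrite addr_eq0 => /eqP fE.
have /andP[l0 l1] := clamp01_itv (2 - `|f y| / e).
have fg : `|f y| <= `|g y - f y| by rewrite {1}fE normrN normrZ ger0_norm // ler_piMl.
by have := lt_trans (le_lt_trans fg (gf y Cy)) fy'; rewrite ltxx.
Qed.

(** If [k] were smaller, [proj] would have an approximation [g] on the trace on [side] everywhere
    linearly independent of a fixed [w]. The linear homotopies from [proj] to [g] and from [g] to
    [w] avoid 0; Borsuk's theorem, applied to the second and then to the first, extends [proj] over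
    [K] without zeros. *)
Lemma linking_side_dim K (Y : set V) (k : int) :
    compact K -> linking K -> Y `<=` @cube R N ->
    K `&` side `<=` Y -> covdim_le Y k ->
  #|(~: J)%SET|%:Z - 1 <= k.
Proof.
move=> kK lK Ycube KsY dimY; rewrite leNgt; apply/negP => km.
have cK : closed K by apply: compact_closed kK; exact: norm_hausdorff.
have cC : closed (K `&` side) by apply: closedI => //; exact: side_closed.
have kC : compact (K `&` side) by exact: subclosed_compact cC kK (@subIsetl _ _ _).
have h0 : 0 < (2^-1 : R) by rewrite invr_gt0.
have [g [w [cg gp gw w0]]] :=
  low_dim_approximation (@cube_compact R N) Ycube kC KsY dimY proj_continuous h0.
have m0 : (0 < #|(~: J)%SET|)%N by have := dimY.1; lia.
have kb (b : R) : k + 1 + (b != 0)%:Z <= #|(~: J)%SET|%:Z.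
  move: km; rewrite -lezD1 lerBrDr => km; apply: le_trans km.
  by rewrite lerD2l; case: (b != 0).
have gw0 a b x : (K `&` side) x -> a *: g x + b *: w = 0 -> a = 0 /\ b = 0.
  by move=> Cx; exact: gw.
pose H1 (z : R * V) : W := (1 - z.1) *: g z.2 + z.1 *: w.
have cfst : continuous (@fst R V) by move=> z; exact: cvg_fst.
have csnd : continuous (@snd R V) by move=> z; exact: cvg_snd.
have csub : continuous (fun z : R * V => 1 - z.1).
  by apply: (@continuous_sub R _ R^o) => //; exact: cst_continuous.
have comp2 (u : V -> W) : continuous u -> continuous (fun z : R * V => u z.2).
  by move=> cu z; apply: (@continuous_comp _ _ _ snd u); [exact: csnd|exact: cu].
have cH1 : continuous H1.
  apply: (@continuous_add R _ W); apply: (@continuous_scale R _ W) => //.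
    exact: comp2.
  exact: cst_continuous.
have [||||f cf [f0 fC]] := @borsuk_extension R N #|(~: J)%SET| K (K `&` side)
  H1 (fun=> w) kK cC (@subIsetl _ _ _) (continuous_subspaceT cH1).
- move=> t x _ Cx; apply/eqP => /gw0-/(_ Cx)[/= t1 t0].
  by move/eqP: t1; rewrite t0 subr0 oner_eq0.
- exact: cst_continuous.
- by move=> x _; exact: w0.
- by move=> x _; rewrite /H1 /= subrr scale0r add0r scale1r.
pose H2 (z : R * V) : W := (1 - z.1) *: proj z.2 + z.1 *: g z.2.
have cH2 : continuous H2.
  apply: (@continuous_add R _ W); apply: (@continuous_scale R _ W) => //.
    exact/comp2/proj_continuous.
  exact: comp2.
have [||h ch [h0' hC]] := @borsuk_extension R N #|(~: J)%SET| K (K `&` side)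
  H2 f kK cC (@subIsetl _ _ _) (continuous_subspaceT cH2) _ cf f0.
(* A zero would make [proj x] no longer than [g x - proj x], yet the former has norm at least 1/2 on
   [side] and the latter less. *)
- move=> t x /andP[t0 t1] [Kx sx]; rewrite /H2 /=; apply/eqP => H0.
  have : `|proj x| <= `|g x - proj x|.
    have pE : proj x = - (t *: (g x - proj x)).
      apply/eqP; rewrite -addr_eq0 -[X in _ == X]H0; apply/eqP.
      by rewrite scalerBl scalerBr scale1r -!addrA; congr (_ + _); rewrite addrC.
    by rewrite {1}pE normrN normrZ ger0_norm // ler_piMl.
  by rewrite leNgt (lt_le_trans (gp x (conj Kx sx)) sx.2).
- move=> x Cx; rewrite fC // /H1 /H2 /= subrr scale0r add0r scale1r.
  by rewrite subr0 scale1r scale0r addr0.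
have [x Kx sx|x Kx hx] := linking_zero kK lK ch.
  by rewrite hC // /H2 /= subr0 scale1r scale0r addr0.
by have := h0' x Kx; rewrite hx eqxx.
Qed.

(** Restricted to the trace of [K] on [side], a homotopy to a constant would let [proj] extend over
    [K] without zeros. *)
Lemma linking_essential K (D : set V) : compact K -> linking K ->
    (forall x, D x -> proj x != 0) -> K `&` side `<=` D ->
  essential R D (@punctured_space R _) proj.
Proof.
move=> kK lK Dp KsD; have cp := proj_continuous.
split; first exact: continuous_subspaceT.
  by move=> _ [x Dx <-]; exact: Dp.
move=> [c c0 [H [cH HY H0 H1]]].
have cK : closed K by apply: compact_closed kK; exact: norm_hausdorff.
have cC : closed (K `&` side) by apply: closedI => //; exact: side_closed.
have cH' : {within `[0, 1] `*` (K `&` side), continuous H}.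
  by apply: continuous_subspaceW cH => -[t x] [/= t01 Cx]; split=> //; exact: KsD.
have [||||f cf [f0 fC]] := borsuk_extension (f := fun=> c) kK cC (@subIsetl _ _ _) cH'.
- move=> t x t01 Cx; apply: HY; exists (t, x) => //; split; last exact: KsD.
  by rewrite /= in_itv.
- exact: cst_continuous.
- by [].
- by move=> x /KsD; exact: H1.
have [x Kx sx|x Kx fx] := linking_zero kK lK cf.
  by rewrite fC // H0 //; exact: KsD.
by have := f0 x Kx; rewrite fx eqxx.
Qed.
End CubeLinking.

(** * Transfer from the cube *)

Lemma closed_within_preimage (T U : topologicalType) (A : set T) (B : set U)
    (f : T -> U) : closed A -> {within A, continuous f} -> closed B ->
  closed (A `&` f @^-1` B).
Proof.
by move=> cA cf cB; rewrite closed_setSI //; move/continuous_closedP : cf; exact.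
Qed.

Lemma open_within_preimage (T U : topologicalType) (A : set T) (B : set U)
    (f : T -> U) : {within A, continuous f} -> open B ->
  exists2 O, open O & forall x, A x -> O x <-> B (f x).
Proof.
move=> /continuousP cf oB; have /open_subspaceP[W oW WB] := cf B oB.
exists W => // x Ax; have : (W `&` A) x <-> (f @^-1` B `&` A) x by rewrite WB.
by move=> [WB1 WB2]; split=> H; [case: WB1|case: WB2].
Qed.

(** Covers are carried to [D] by the inverse [g] and refinements back by [h]. Both maps are
    continuous only within [B] and [A], so preimages are replaced by open sets with the same
    traces. *)
Lemma covdim_le_preimage (T U : topologicalType) (A : set T) (B D : set U)
    (h : T -> U) (k : int) : homeomorphism_onto A B h -> D `<=` B ->
  covdim_le D k -> covdim_le [set x | A x /\ D (h x)] k.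
Proof.
move=> [[hAB hinj hsurj] ch [g gK cg]] DB [k1 dimD]; split=> // p O oO AO.
have /choice[Q QP] : forall i, exists W, open W /\ forall y, B y -> W y <-> O i (g y).
  by move=> i; have [W] := open_within_preimage cg (oO i); exists W.
have ghx x : A x -> g (h x) = x by move=> Ax; apply: gK; exact: mem_set.
have [|y Dy|q [V [oV DV Vref Vord]]] := dimD p Q.
- by move=> i; exact: (QP i).1.
- have [x Ax xy] := hsurj y (DB y Dy); rewrite -xy in Dy *.
  have [i _ Oi] := AO x (conj Ax Dy); exists i => //.
  by apply/((QP i).2 _ (DB _ Dy)); rewrite ghx.
have /choice[V' V'P] : forall j, exists V', open V' /\ forall x, A x -> V' x <-> V j (h x).
  by move=> j; have [V'] := open_within_preimage ch (oV j); exists V'.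
exists q, V'; split.
- by move=> j; exact: (V'P j).1.
- move=> x [Ax Dx]; have [j _ Vj] := DV _ Dx; exists j => //.
  exact/((V'P j).2 _ Ax).
- move=> j; have [i Vi] := Vref j; exists i => x [[Ax Dx] V'x].
  have : Q i (h x) by apply: Vi; split=> //; exact/((V'P j).2 _ Ax).
  by move/((QP i).2 _ (DB _ Dx)); rewrite ghx.
- move=> x [Ax Dx]; apply: le_trans (Vord _ Dx).
  rewrite lez_nat; apply: subset_leq_card; apply/fintype.subsetP => j.
  by rewrite !inE => /((V'P j).2 _ Ax).
Qed.

Theorem theorem4p3 (R : realType) (Z : metricType R) (N n : nat)
    (X : set Z) (h : 'rV[R]_N -> Z) (i : 'I_n -> 'I_N) (S : 'I_N -> set Z)
    (Xh : gen_rectangle X h)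
    (n_ge1 : (1 <= n)%N)
    (i_incr : forall k l : 'I_n, (k < l)%N -> (i k < i l)%N)
    (S_sub : forall k, S (i k) `<=` X)
    (S_compact : forall k, compact (S (i k)))
    (S_cuts : forall k,
      cuts_arcs R X (left_face h (i k)) (right_face h (i k)) (S (i k))) :
  \bigcap_(k in [set: 'I_n]) S (i k) !=set0 /\
  exists K : set Z,
    [/\ K !=set0, compact K, connected K &
        K `<=` \bigcap_(k in [set: 'I_n]) S (i k)] /\
    [/\ forall z, K z -> covdim_ge_at K z (N%:Z - n%:Z),
        covdim_ge (K `&` contour h) (N%:Z - n%:Z - 1) &
        essential R (boundary_trace h (i @: 'I_n)%SET K)
          (@punctured_space R _) (centered_proj (i @: 'I_n)%SET)].
Proof.
set J := (i @: 'I_n)%SET.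
have [[hX hinj hsurj] ch _] := Xh.
have i_inj : injective i.
  move=> k l ikl; have [kl|kl|kl] := ltngtP (k : nat) l.
  - by have := i_incr _ _ kl; rewrite ikl ltnn.
  - by have := i_incr _ _ kl; rewrite ikl ltnn.
  - exact: ord_inj.
have cardJ : #|(~: J)%SET|%:Z = N%:Z - n%:Z.
  have cJ : (n + #|(~: J)%SET| = N)%N.
    by have := cardsC J; rewrite card_imset // !card_ord.
  by apply/eqP; rewrite eq_sym subr_eq -PoszD addnC cJ.
pose S' j := @cube R N `&` h @^-1` S j.
have cS j : j \in J -> closed (S' j).
  move=> /imsetP[k _ ->]; apply: closed_within_preimage => //.
    exact: cube_closed.
  by apply: compact_closed (S_compact k); exact: metric_hausdorff.
pose K0 := [set x | @cube R N x /\ forall j, j \in J -> S' j x].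
have lK0 : linking J K0.
  apply: linking_intersection cS _ => _ /imsetP[k _ ->] gam cgam gamC gam0 gam1.
  (* [h] is continuous only within the cube, but [gam] never leaves it. *)
  have chg : continuous (h \o gam).
    move=> t B hB; have Bt := (within_continuousP _ _).1 ch _ _ (gamC t) hB.
    have : nbhs t (gam @^-1` [set y | cube y -> B (h y)]) := cgam t _ Bt.
    by apply: filterS => s /(_ (gamC s)).
  have [||||z [[t _ <-] St]] := S_cuts k (h \o gam).
  - exact: continuous_subspaceT.
  - by move=> _ [t _ <-]; apply: hX; exact: gamC.
  - exists (h (gam 0)); split; first by exists 0; rewrite //= in_itv /= lexx ler01.
    by exists (gam 0).
  - exists (h (gam 1)); split; first by exists 1; rewrite //= in_itv /= lexx ler01.
    by exists (gam 1).
  by exists t; split=> //; exact: gamC.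
have kK0 : compact K0.
  apply: subclosed_compact (@cube_compact R N) _ => [|x []//].
  have -> : K0 = @cube R N `&` \bigcap_(j in [set j | j \in J]) S' j by [].
  by apply: closedI; [exact: cube_closed|apply: closed_bigI].
have [K' K'K0 mK'] := exists_minimal_linking kK0 lK0.
have [kK' lK' _] := mK'.
have K'cube : K' `<=` @cube R N by move=> x /K'K0[].
pose K := h @` K'.
have KX : K `<=` X by move=> _ [x /K'cube cx <-]; exact: hX.
have KK' x : cube x -> K (h x) -> K' x.
  move=> cx [y Ky] hyx; rewrite -(hinj y x) ?inE //; exact: K'cube.
have chK : {within K', continuous h} := continuous_subspaceW K'cube ch.
have KS : K `<=` \bigcap_(k in [set: 'I_n]) S (i k).
  by move=> _ [x /K'K0[_ SK] <-] k _; exact: (SK _ (imset_f i isT)).2.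
have K0' : K !=set0 by have [x K'x] := linking_nonempty lK'; exists (h x), x.
split; first by have [z Kz] := K0'; exists z; exact: KS.
exists K; split; first split=> //.
- exact: continuous_compact.
- by apply: connected_continuous_connected => //; exact: minimal_linking_connected mK'.
rewrite -cardJ; split.
- move=> _ [x K'x <-] W Wx k dimW.
  have [U [oU Ux] UW] : exists2 U, open U /\ U x & forall y, U y -> cube y -> W (h y).
    have : nbhs x [set y | cube y -> W (h y)] :=
      (within_continuousP _ _).1 ch x W (K'cube x K'x) Wx.
    by rewrite nbhsE => -[U [oU Ux] UW]; exists U.
  (* The points of the cube over [K] and [W] form a set between the trace of [K'] on [U] and [K']
     itself. *)
  have dimY := covdim_le_preimage Xh (subset_trans (@subIsetl _ _ _) KX) dimW.
  apply: (minimal_linking_dim mK' K'cube K'x oU Ux _ _ dimY).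
    move=> y [K'y Uy]; split; first exact: K'cube.
    by split; [exists y|apply: UW; rewrite //; exact: K'cube].
  by move=> y [cy [Ky _]]; exact: KK'.
- move=> k dimK.
  have dimY := covdim_le_preimage Xh (subset_trans (@subIsetl _ _ _) KX) dimK.
  (* As [side] lies in the boundary of the cube, [h] maps the trace of [K'] on it into the
     contour. *)
  apply: (linking_side_dim kK' lK' _ _ dimY); first by move=> y [].
  move=> y [K'y sy]; split; first exact: K'cube.
  by split; [exists y|exists y => //; exact: side_boundary sy].
- apply: linking_essential lK' _ _ => //.
    by move=> x [].
  move=> x [K'x sx]; split; [by exists x|exact: side_boundary sx|exact: side_proj_neq0].
Qed.
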